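(* Let $\mathcal{T}=\{T_\alpha : \alpha \in \Lambda\}$ be a $q$-commuting family of contractions with $\|q\|=1$ acting on a Hilbert space $\mathcal{H}$. Then $\mathcal{T}$ admits a regular $q$-unitary dilation if and only if \[ S(u)= \sum_{\{\alpha_1, \dotsc, \alpha_m\} \subset u}(-1)^m(T_{\alpha_1}\dotsc T_{\alpha_m})^*(T_{\alpha_1}\dotsc T_{\alpha_m}) \geq 0 \] for every finite subset $u$ of $\Lambda$.
   Context: A family $\mathcal{T}=\{T_\alpha: \alpha \in \Lambda\}$ of operators on a Hilbert space $\mathcal{H}$ is $q$-commuting with $\|q\|=1$ if there is a family of scalars $q=\{q_{\alpha\beta}\in\mathbb{C} : |q_{\alpha\beta}|=1,\ q_{\alpha\beta}=q_{\beta\alpha}^{-1},\ \alpha\neq\beta\in\Lambda\}$ such that $T_\alpha T_\beta=q_{\alpha\beta}T_\beta T_\alpha$ for all $\alpha\neq\beta$ in $\Lambda$. For $m\in\mathbb{Z}$, $m^+=\max\{m,0\}$ and $m^-=-\min\{m,0\}$. Such a family of contractions admits a regular $q$-unitary dilation if there exist a Hilbert space $\mathcal{K}\supseteq\mathcal{H}$ and a $q$-commuting family (with the same $q$) $\mathcal{U}=\{U_\alpha:\alpha\in\Lambda\}$ of unitaries on $\mathcal{K}$ such that \[ \prod_{1\leq i<j \leq k} q_{\alpha_{i}\alpha_{j}}^{-m_{\alpha_{i}}^+m_{\alpha_{j}}^-}\left[(T_{\alpha_{1}}^{m_{\alpha_{1}}^-})^*\dotsc (T_{\alpha_{k}}^{m_{\alpha_{k}}^-})^*\right]\left[T_{\alpha_{1}}^{m_{\alpha_{1}}^+}\dotsc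 T_{\alpha_{k}}^{m_{\alpha_{k}}^+}\right]=P_\mathcal{H}U_{\alpha_{1}}^{m_{\alpha_{1}}}\dotsc U_{\alpha_{k}}^{m_{\alpha_{k}}}|_\mathcal{H} \] for every $m_{\alpha_1},\dotsc,m_{\alpha_k}\in\mathbb{Z}$ and $\alpha_1,\dotsc,\alpha_k\in\Lambda$. *)

(* Defs.v *)
From mathcomp Require Import all_boot all_algebra complex reals.
From Stdlib Require ClassicalEpsilon List.
Set Implicit Arguments. Unset Strict Implicit. Unset Printing Implicit Defensive.
Import GRing.Theory Num.Theory.
Local Open Scope ring_scope.

Section Hilbert.
Variable R : realType.
Local Notation C := R[i].

Definition inner_product (V : lmodType C) (ip : V -> V -> C) : Prop :=
  [/\ forall (a : C) (x1 x2 y : V), ip (a *: x1 + x2) y = a * ip x1 y + ip x2 y,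
      forall x y : V, ip y x = Num.conj (ip x y),
      forall x : V, 0 <= ip x x
    & forall x : V, ip x x = 0 -> x = 0].

Definition hnorm (V : lmodType C) (ip : V -> V -> C) (x : V) : C := sqrtC (ip x x).

Definition hilbert (V : lmodType C) (ip : V -> V -> C) : Prop :=
  inner_product ip /\
  forall u : nat -> V,
    (forall e : C, 0 < e -> exists N : nat, forall n p : nat,
        (N <= n)%N -> (N <= p)%N -> hnorm ip (u n - u p) < e) ->
    exists l : V, forall e : C, 0 < e -> exists N : nat, forall n : nat,
        (N <= n)%N -> hnorm ip (u n - l) < e.

(* The Hilbert-space adjoint T^* : W -> V of T : V -> W (the map S with
   <T x, y> = <x, S y>; it exists and is unique for bounded T). *)
Definition hadj (V W : lmodType C) (ipV : V -> V -> C) (ipW : W -> W -> C)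
  (T : V -> W) : W -> V :=
  ClassicalEpsilon.epsilon (inhabits (fun _ : W => 0 : V))
    (fun S : W -> V => forall (x : V) (y : W), ipW (T x) y = ipV x (S y)).

Definition contraction (V : lmodType C) (ip : V -> V -> C) (T : V -> V) : Prop :=
  linear T /\ forall x : V, hnorm ip (T x) <= hnorm ip x.

Definition unitary (V : lmodType C) (ip : V -> V -> C) (U : V -> V) : Prop :=
  linear U /\ exists S : V -> V,
    (forall x y : V, ip (U x) y = ip x (S y)) /\ cancel U S /\ cancel S U.

Definition isometric_embedding (V W : lmodType C) (ipV : V -> V -> C)
  (ipW : W -> W -> C) (J : V -> W) : Prop :=
  linear J /\ forall x y : V, ipW (J x) (J y) = ipV x y.

Definition unimodular_q (L : Type) (q : L -> L -> C) : Prop :=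
  forall a b : L, a <> b -> `|q a b| = 1 /\ q a b = (q b a)^-1.

Definition q_commuting (V : lmodType C) (L : Type) (q : L -> L -> C)
  (T : L -> V -> V) : Prop :=
  forall a b : L, a <> b -> forall x : V, T a (T b x) = q a b *: T b (T a x).

Definition mplus (m : int) : nat := match m with Posz n => n | Negz _ => 0%N end.
Definition mminus (m : int) : nat := match m with Posz _ => 0%N | Negz n => n.+1 end.

Definition upow (V : lmodType C) (ip : V -> V -> C) (U : V -> V) (m : int) : V -> V :=
  match m with
  | Posz n => iter n U
  | Negz n => iter n.+1 (hadj ip ip U)
  end.

Definition fcomp (V : Type) (f g : V -> V) : V -> V := fun x => f (g x).

Definition prodT (V : Type) (L : Type) (T : L -> V -> V) (s : seq L) : V -> V :=
  foldr (fun a f => fcomp (T a) f) idfun s.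

(* Regular q-unitary dilation, with K containing H via the isometry J,
   so that P_H X |_H corresponds to J^* X J. *)
Definition regular_q_unitary_dilation (H : lmodType C) (ipH : H -> H -> C)
  (L : Type) (q : L -> L -> C) (T : L -> H -> H)
  (K : lmodType C) (ipK : K -> K -> C) (J : H -> K) (U : L -> K -> K) : Prop :=
  [/\ isometric_embedding ipH ipK J,
      forall a : L, unitary ipK (U a),
      q_commuting q U
    & forall (k : nat) (a : 'I_k -> L) (m : 'I_k -> int), injective a ->
      forall x : H,
        hadj ipH ipK J ((\big[@fcomp K/idfun]_(i < k) upow ipK (U (a i)) (m i)) (J x))
        = (\prod_(i < k) \prod_(j < k | (i < j)%N)
              q (a i) (a j) ^ (- ((mplus (m i) * mminus (m j))%N : int)))
          *: (\big[@fcomp H/idfun]_(i < k) hadj ipH ipH (iter (mminus (m i)) (T (a i))))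
               ((\big[@fcomp H/idfun]_(i < k) iter (mplus (m i)) (T (a i))) x)].

Definition admits_regular_q_unitary_dilation (H : lmodType C) (ipH : H -> H -> C)
  (L : Type) (q : L -> L -> C) (T : L -> H -> H) : Prop :=
  exists (K : lmodType C) (ipK : K -> K -> C) (J : H -> K) (U : L -> K -> K),
    hilbert ipK /\ regular_q_unitary_dilation ipH q T ipK J U.

(* S(u) for a finite subset u of L, given as a duplicate-free list s:
   sum over all subsets {a_1..a_m} of u of (-1)^m (T_{a_1}..T_{a_m})^* (T_{a_1}..T_{a_m}). *)
Definition S_op (H : lmodType C) (ipH : H -> H -> C) (L : Type) (T : L -> H -> H)
  (s : seq L) (x : H) : H :=
  \sum_(b : (size s).-tuple bool)
     (-1 : C) ^+ size (mask b s) *: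
       hadj ipH ipH (prodT T (mask b s)) (prodT T (mask b s) x).

Definition positive_op (H : lmodType C) (ipH : H -> H -> C) (S : H -> H) : Prop :=
  forall x : H, 0 <= ipH (S x) x.

End Hilbert.

(* Main.v *)
(* A family with unitary dilation [U] is regular exactly when [U a J - J (T a)] maps into a space
   orthogonal to [J H] and stable under the [U b^{+-1}], [b <> a], and under [U a].

   Necessity: the vector [e_s x], defined by [e_[] x = J x] and
   [e_(a, s) x = e_s x - U_a^* e_s (T_a x)], satisfies [|e_s x|^2 = <S(s) x, x>], because
   [U_a e_s x - e_s (T_a x)] is orthogonal to the range of [e_s].

   Sufficiency: for finite [s] the operators are made unitary one at a time, on pre-Hilbert spaces.
   Dilating [T_a] turns the form [S(t)], for [a] not in [t], into
   [y |-> <S(t) y_n, y_n> + \sum_(p < n) <S(a, t) y_p, y_p>], so positivity is inherited and the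
   construction can be iterated. Regularity determines the value [<U_w J x, J x'>] of every word [w]
   in the [U_a^{+-1}], so the finite dilations agree on common words and define a positive form on
   formal combinations of the vectors [U_w J x], for all words on the whole index set; its
   completion is the dilation space. *)
From HB Require Import structures.
Require Import Defs.
From mathcomp Require Import all_boot all_order all_algebra complex reals.
From mathcomp Require Import boolp classical_sets functions ring lra zify.
From Stdlib Require List.
Set Implicit Arguments. Unset Strict Implicit. Unset Printing Implicit Defensive.
Import Order.TTheory GRing.Theory Num.Theory.
Import ComplexField.Normc.
Local Open Scope ring_scope.

(** * Limits of complex sequences *)

Section ComplexLimits.
Variable R : realType.
Local Notation C := R[i].
Local Notation Re := complex.Re.
Local Notation Im := complex.Im.
Implicit Types (z : C) (u v : nat -> C) (l : C).

(** The regularity formula concerns all words at once and does not pass through an induction on the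
    index set. The stable orthogonal spaces do: after one more operator is dilated they can be
    described entry by entry. The induction therefore carries these spaces, and the formula is
    recovered from them at the end. A finite dilation depends on the order in which its operators
    were treated, and no natural maps connect the dilation spaces of different lists; gluing
    therefore takes place among scalars, the inner products of words. Each step is algebraic, since
    the sequences in use are eventually constant or orbits and their norms are finite sums, so
    completing once at the end suffices. Positivity is semi-definite until then, and every estimate
    has to tolerate null vectors. *)

Lemma ReD (x y : C) : Re (x + y) = Re x + Re y. Proof. by case: x y => [? ?] []. Qed.
Lemma ReN (x : C) : Re (- x) = - Re x. Proof. by case: x. Qed.
Lemma ReJ (x : C) : Re x^* = Re x. Proof. by case: x. Qed.
Lemma conjCR (r : R) : (r%:C%C)^* = r%:C%C :> C.
Proof. exact: conjc_real. Qed.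
Lemma ReMl (r : R) (x : C) : Re (r%:C%C * x) = r * Re x.
Proof. by case: x => a b /=; rewrite mul0r subr0. Qed.
Lemma ReE (z : C) : 0 <= z -> z = (Re z)%:C%C.
Proof. by move=> /ger0_real/RRe_real ->. Qed.
Lemma Re_ge0 (z : C) : 0 <= z -> 0 <= Re z.
Proof. by move=> z0; move: (z0); rewrite {1}(ReE z0) ler0c. Qed.

Lemma normcD (x y : C) : normc (x + y) <= normc x + normc y.
Proof. exact: le_normcD. Qed.
Lemma normc_ge0 (x : C) : 0 <= normc x.
Proof. by case: x => a b; rewrite sqrtr_ge0. Qed.
Lemma normcJ (x : C) : normc x^* = normc x.
Proof. by case: x => a b; rewrite /normc /= sqrrN. Qed.
Lemma normcB (x y : C) : normc (x - y) = normc (y - x).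
Proof. by rewrite -opprB normcN. Qed.
Lemma normc_sqr (x : C) : x * x^* = ((normc x) ^+ 2)%:C%C.
Proof. by rewrite -normCK rmorphXn; case: x. Qed.
Lemma Re_le_normc (x : C) : `|Re x| <= normc x.
Proof. by case: x => a b /=; rewrite -sqrtr_sqr ler_wsqrtr // lerDl sqr_ge0. Qed.
Lemma Im_le_normc (x : C) : `|Im x| <= normc x.
Proof. by case: x => a b /=; rewrite -sqrtr_sqr ler_wsqrtr // lerDr sqr_ge0. Qed.
Lemma normc_le_ReIm (x : C) : normc x <= `|Re x| + `|Im x|.
Proof.
case: x => a b; rewrite -(ler_pXn2r (_ : (0 < 2)%N)) ?nnegrE ?normc_ge0 ?addr_ge0 //=.
rewrite sqr_sqrtr ?addr_ge0 ?sqr_ge0 // sqrrD -(real_normK (num_real a)) -(real_normK (num_real b)).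
by rewrite addrAC lerDl mulrn_wge0 // mulr_ge0.
Qed.

Definition clim u l := forall e : R, 0 < e -> exists N, forall n, (N <= n)%N -> normc (u n - l) < e.
Definition ccauchy u := forall e : R, 0 < e ->
  exists N, forall n m, (N <= n)%N -> (N <= m)%N -> normc (u n - u m) < e.

Lemma clim_ext u v l : u =1 v -> clim u l -> clim v l.
Proof. by move=> uv ul e /ul[N h]; exists N => n /h; rewrite uv. Qed.

Lemma climD u v l k : clim u l -> clim v k -> clim (fun n => u n + v n) (l + k).
Proof.
move=> ul vk e e0; have e2 : 0 < e / 2 by lra.
have [N h] := ul _ e2; have [M g] := vk _ e2; exists (maxn N M) => n.
rewrite geq_max => /andP[/h h1 /g g1]; rewrite opprD addrACA.
by have := normcD (u n - l) (v n - k); lra.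
Qed.

Lemma climZ u l a : clim u l -> clim (fun n => a * u n) (a * l).
Proof.
move=> ul e e0; have a0 := normc_ge0 a.
have [N h] := ul (e / (normc a + 1)) ltac:(by apply: divr_gt0; lra).
exists N => n /h; rewrite -mulrBr normcM ltr_pdivlMr; last by lra.
by have := normc_ge0 (u n - l); nra.
Qed.

Lemma climJ u l : clim u l -> clim (fun n => (u n)^*) l^*.
Proof. by move=> ul e /ul[N h]; exists N => n /h; rewrite -rmorphB normcJ. Qed.

Lemma clim_cst l : clim (fun=> l) l.
Proof. by move=> e e0; exists 0%N => n _; rewrite subrr normc0. Qed.

Lemma clim_norm_le u l M : clim u l -> (exists N, forall n, (N <= n)%N -> normc (u n) <= M) -> normc l <= M.
Proof.
move=> ul [N0 uM]; rewrite leNgt; apply/negP => Ml.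
have [N h] := ul (normc l - M) ltac:(lra).
have := normcD (l - u (maxn N N0)) (u (maxn N N0)); rewrite subrK normcB.
by have := h _ (leq_maxl N N0); have := uM _ (leq_maxr N N0); lra.
Qed.

Lemma clim_uniq u l k : clim u l -> clim u k -> l = k.
Proof.
move=> ul uk; apply/eqP; rewrite -subr_eq0; apply/eqP/eq0_normc/le_anti/andP; split; last exact: normc_ge0.
have h : clim (fun n => u n + (-1) * u n) (l + (-1) * k) by apply: climD => //; apply: climZ.
rewrite mulN1r in h; apply: (clim_norm_le h).
by exists 0%N => n _; rewrite mulN1r subrr normc0.
Qed.

Lemma clim_ge0 u l : clim u l -> (forall n, 0 <= u n) -> 0 <= l.
Proof.
move=> ul u0; have lr : l = l^*.
  by apply: (clim_uniq ul); apply: (clim_ext _ (climJ ul)) => n; rewrite geC0_conj.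
have le : l = (Re l)%:C%C by rewrite RRe_real //; apply/CrealP.
rewrite le ler0c leNgt; apply/negP => l0.
have [N h] := ul (- Re l) ltac:(lra).
have := Re_le_normc (u N - l); have := h N (leqnn _); rewrite ReD ReN.
by have := Re_ge0 (u0 N); move=> h0; rewrite ger0_norm; lra.
Qed.

Lemma real_complete (u : nat -> R) :
  (forall e : R, 0 < e -> exists N, forall n m, (N <= n)%N -> (N <= m)%N -> `|u n - u m| < e) ->
  exists r, forall e : R, 0 < e -> exists N, forall n, (N <= n)%N -> `|u n - r| < e.
Proof.
(* [A] collects the eventual lower bounds of [u]; its supremum is the lower limit, which for a
   Cauchy sequence is the limit. *)
move=> uc; pose A := [set x | exists N, forall n, (N <= n)%N -> x <= u n]%classic.
have low e : 0 < e -> exists N, A (u N - e) /\ (forall x, A x -> x <= u N + e) /\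
    forall n, (N <= n)%N -> `|u n - u N| < e.
  move=> /uc[N h]; exists N; split; [exists N => n Nn|split => [x [M g]|n Nn]].
  - by have := h _ _ Nn (leqnn N); rewrite ltr_norml => /andP[]; lra.
  - have := h _ _ (leq_maxl N M) (leqnn N); have := g _ (leq_maxr N M).
    by rewrite ltr_norml => ? /andP[]; lra.
  - exact: h.
have hs : has_sup A.
  have [N [h1 [h2 _]]] := low 1 ltr01.
  by split; [exists (u N - 1)|exists (u N + 1) => x /h2].
exists (sup A) => e e0; have [N [h1 [h2 h3]]] := low (e / 2) ltac:(lra).
exists N => n /h3; have := ub_le_sup hs.2 h1.
have : sup A <= u N + e / 2 by apply: ge_sup => //; exact: hs.1.
by rewrite !ltr_norml => ? ? /andP[? ?]; apply/andP; lra.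
Qed.

Lemma ccomplete u : ccauchy u -> exists l, clim u l.
Proof.
move=> uc.
have [|a ha] := @real_complete (fun n => Re (u n)).
  move=> e /uc[N h]; exists N => n m Nn Nm; have := h _ _ Nn Nm.
  by have := Re_le_normc (u n - u m); rewrite ReD ReN; lra.
have [|b hb] := @real_complete (fun n => Im (u n)).
  move=> e /uc[N h]; exists N => n m Nn Nm; have := h _ _ Nn Nm.
  have := Im_le_normc (u n - u m).
  have -> : Im (u n - u m) = Im (u n) - Im (u m) by case: (u n) (u m) => [? ?] [].
  lra.
exists (a +i* b)%C => e e0; have [N h] := ha (e / 2) ltac:(lra).
have [M g] := hb (e / 2) ltac:(lra); exists (maxn N M) => n.
rewrite geq_max => /andP[/h h1 /g g1].
have := normc_le_ReIm (u n - (a +i* b)%C).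
by case: (u n) h1 g1 => [c d] /=; lra.
Qed.

End ComplexLimits.

(** * Completion of a positive sesquilinear form *)

Section Submodule.
Variables (R : realType) (W : lmodType R[i]).

Record submodule := Submodule {
  smem :> W -> Prop;
  smem0 : smem 0;
  smemZD : forall a x y, smem x -> smem y -> smem (a *: x + y) }.

Variable P : submodule.
Definition smem_pred : {pred W} := fun w => `[< P w >].
Lemma smem_pred_closed : submod_closed smem_pred.
Proof.
split; first exact/asboolP/smem0.
by move=> a x y /asboolP xP /asboolP yP; apply/asboolP/smemZD.
Qed.
HB.instance Definition _ := GRing.isSubmodClosed.Build _ _ smem_pred smem_pred_closed.

Record smod := SMod { smod_val : W; smod_valP : smod_val \in smem_pred }.
HB.instance Definition _ := [isSub for smod_val].
HB.instance Definition _ := [Choice of smod by <:].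
HB.instance Definition _ := [SubChoice_isSubLmodule of smod by <:].

Definition smod_of (w : W) : smod := insubd (0 : smod) w.
Lemma smod_ofK w : P w -> smod_val (smod_of w) = w.
Proof. by move=> /asboolP wP; exact: insubdK. Qed.
Lemma smodP (x : smod) : P (smod_val x).
Proof. exact/asboolP/smod_valP. Qed.
Lemma smod_inj (x y : smod) : smod_val x = smod_val y -> x = y.
Proof. exact: val_inj. Qed.
Lemma smod_valD (x y : smod) : smod_val (x + y) = smod_val x + smod_val y.
Proof. by []. Qed.
Lemma smod_valZ a (x : smod) : smod_val (a *: x) = a *: smod_val x.
Proof. by []. Qed.
End Submodule.

Section PreHilbert.
Variables (R : realType).
Local Notation C := R[i].
Local Notation Re := complex.Re.
Variables (V : Type) (add : V -> V -> V) (scl : C -> V -> V) (B : V -> V -> C).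

(* No vector-space axioms are required of [add] and [scl], so that lists of formal linear
   combinations qualify. *)
Record preip : Prop := PreIp {
  preipD : forall u v w, B (add u v) w = B u w + B v w;
  preipZ : forall c u w, B (scl c u) w = c * B u w;
  preipJ : forall u v, B v u = (B u v)^*;
  preip_ge0 : forall u, 0 <= B u u }.

Hypothesis Bpre : preip.
Let Badd := preipD Bpre.
Let Bscl := preipZ Bpre.
Let Bh := preipJ Bpre.
Let Bp := preip_ge0 Bpre.

Lemma preipDr u v w : B w (add u v) = B w u + B w v.
Proof. by rewrite Bh Badd rmorphD (Bh u w) (Bh v w). Qed.
Lemma preipZr c u w : B w (scl c u) = c^* * B w u.
Proof. by rewrite Bh Bscl rmorphM (Bh u w). Qed.

Definition nsq u : R := Re (B u u).
Definition psub u v := add u (scl (-1) v).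

Lemma nsqE u : B u u = (nsq u)%:C%C. Proof. exact: ReE. Qed.
Lemma nsq_ge0 u : 0 <= nsq u. Proof. exact: Re_ge0. Qed.

Lemma preipBl u v w : B (psub u v) w = B u w - B v w.
Proof. by rewrite Badd Bscl mulN1r. Qed.
Lemma preipBr u v w : B w (psub u v) = B w u - B w v.
Proof. by rewrite preipDr preipZr rmorphN rmorph1 mulN1r. Qed.

Lemma nsq_psub_sym u v : nsq (psub u v) = nsq (psub v u).
Proof. by rewrite /nsq !(preipBl, preipBr); congr (Re _); ring. Qed.

Lemma cauchy_schwarz u v : (normc (B u v)) ^+ 2 <= nsq u * nsq v.
Proof.
set s := B u v; set N := (normc s) ^+ 2.
have N0 : 0 <= N by rewrite exprn_ge0 ?normc_ge0.
have NE : N%:C%C = s * s^* by rewrite normc_sqr.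
clearbody N.
(* Positivity at [u - t s v] for real [t]: the factor [s = B u v] makes both cross terms equal to
   the real number [- t N]. *)
have key (t : R) : 0 <= nsq u - 2 * t * N + t ^+ 2 * N * nsq v.
  have := Bp (add u (scl (- t%:C%C * s) v)).
  rewrite !(Badd, Bscl, preipDr, preipZr) (Bh u v) -/s !nsqE.
  rewrite rmorphM rmorphN /= conjCR.
  set a := (X in 0 <= X); have -> : a = (nsq u - 2 * t * N + t ^+ 2 * N * nsq v)%:C%C.
    rewrite /a !(rmorphD, rmorphN, rmorphM) /= NE.
    ring.
  by rewrite ler0c.
(* For a null vector [v] the bound [key] is affine in [t] and fails for large [t] unless [N]
   vanishes; otherwise [t = 1 / nsq v] is optimal. *)
have [v0|v0] := eqVneq (nsq v) 0.
  rewrite v0 mulr0 leNgt; apply/negP => Np.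
  have := key ((nsq u + 1) / N); rewrite v0 mulr0 addr0.
  have -> : 2 * ((nsq u + 1) / N) * N = 2 * (nsq u + 1) by field; lra.
  by have := nsq_ge0 u; lra.
have vp : 0 < nsq v by rewrite lt_def v0 nsq_ge0.
have := key (nsq v)^-1.
have -> : nsq u - 2 * (nsq v)^-1 * N + (nsq v)^-1 ^+ 2 * N * nsq v = nsq u - N / nsq v by field.
by rewrite subr_ge0 ler_pdivrMr.
Qed.

Lemma cs_lt e u v : 0 < e -> nsq u * nsq v < e ^+ 2 -> normc (B u v) < e.
Proof.
move=> e0 h; rewrite -(ltr_pXn2r (_ : (0 < 2)%N)) ?nnegrE ?normc_ge0 ?ltW //.
exact: le_lt_trans (cauchy_schwarz u v) h.
Qed.

Lemma parallelogram u v : nsq (add u v) + nsq (psub u v) = 2 * nsq u + 2 * nsq v.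
Proof.
have -> : 2 * nsq u + 2 * nsq v = Re (B u u + B u u + (B v v + B v v)) by rewrite !ReD /nsq; ring.
by rewrite /nsq -ReD !(preipBl, preipBr, Badd, preipDr); congr (Re _); ring.
Qed.

(** A substitute for the triangle inequality that keeps the estimates among squared norms, at the
    price of the factors 2 in the choices of epsilon below. *)
Lemma nsqD_le u v : nsq (add u v) <= 2 * nsq u + 2 * nsq v.
Proof. by rewrite -parallelogram lerDl nsq_ge0. Qed.

Lemma nsq_split u v : nsq u <= 2 * nsq (psub u v) + 2 * nsq v.
Proof.
have -> : nsq u = nsq (add (psub u v) v); last exact: nsqD_le.
by rewrite /nsq !(preipBl, preipBr, Badd, preipDr); congr (Re _); ring.
Qed.

Lemma nsq_triangle w u v : nsq (psub u v) <= 2 * nsq (psub u w) + 2 * nsq (psub w v).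
Proof.
have -> : nsq (psub u v) = nsq (add (psub u w) (psub w v)); last exact: nsqD_le.
by rewrite /nsq !(preipBl, preipBr, Badd, preipDr); congr (Re _); ring.
Qed.

Definition vcauchy (v : nat -> V) := forall e : R, 0 < e ->
  exists N, forall n m, (N <= n)%N -> (N <= m)%N -> nsq (psub (v n) (v m)) < e.

Lemma vcauchy_bounded v : vcauchy v ->
  exists M : R, 0 < M /\ exists N, forall n, (N <= n)%N -> nsq (v n) <= M.
Proof.
move=> /(_ 1 ltr01)[N h]; exists (2 + 2 * nsq (v N)); have v0 := nsq_ge0 (v N).
split; first lra.
by exists N => n Nn; have := h _ _ Nn (leqnn N); have := nsq_split (v n) (v N); lra.
Qed.

Lemma vcauchy_preip u v : vcauchy u -> vcauchy v -> ccauchy (fun n => B (u n) (v n)).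
Proof.
move=> uc vc e e0; have [M [M0 [N uM]]] := vcauchy_bounded uc.
have [M' [M'0 [N' vM]]] := vcauchy_bounded vc.
have [N1 h1] := uc ((e / 2) ^+ 2 / (M' + 1)) ltac:(by apply: divr_gt0; [apply: exprn_gt0|]; lra).
have [N2 h2] := vc ((e / 2) ^+ 2 / (M + 1)) ltac:(by apply: divr_gt0; [apply: exprn_gt0|]; lra).
exists (maxn (maxn N N') (maxn N1 N2)) => n m; rewrite !geq_max.
move=> /andP[/andP[_ n'] /andP[n1 n2]] /andP[/andP[m0 _] /andP[m1 m2]].
have -> : B (u n) (v n) - B (u m) (v m) = B (psub (u n) (u m)) (v n) + B (u m) (psub (v n) (v m)).
  by rewrite preipBl preipBr; ring.
have i1 : normc (B (psub (u n) (u m)) (v n)) < e / 2.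
  apply: cs_lt; first lra; have := h1 _ _ n1 m1; rewrite ltr_pdivlMr; last lra.
  have := vM _ n'; have := nsq_ge0 (psub (u n) (u m)); have := nsq_ge0 (v n); nra.
have i2 : normc (B (u m) (psub (v n) (v m))) < e / 2.
  apply: cs_lt; first lra; have := h2 _ _ n2 m2; rewrite ltr_pdivlMr; last lra.
  have := uM _ m0; have := nsq_ge0 (psub (v n) (v m)); have := nsq_ge0 (u m); nra.
have := normcD (B (psub (u n) (u m)) (v n)) (B (u m) (psub (v n) (v m))); lra.
Qed.

(** The ideal limit of [v] is represented by the functional it induces, so that sequences at
    distance zero are identified automatically. *)
Definition rep (v : nat -> V) (f : V -> C) := vcauchy v /\ forall u, clim (fun n => B (v n) u) (f u).

(** The difference is the limit over [m] of [B (v n - v m) (u n)], small by Cauchy-Schwarz because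
    [u] is eventually bounded. Hence limits of forms depend on [v] only through [f]. *)
Lemma rep_diag v f u : rep v f -> vcauchy u -> clim (fun n => B (v n) (u n) - f (u n)) 0.
Proof.
move=> [vc vf] uc e e0; have [M [M0 [N uM]]] := vcauchy_bounded uc.
have [N1 h1] := vc ((e / 2) ^+ 2 / M) ltac:(by apply: divr_gt0; [apply: exprn_gt0|]; lra).
exists (maxn N N1) => n; rewrite geq_max subr0 => /andP[nN n1].
suff : normc (B (v n) (u n) - f (u n)) <= e / 2 by lra.
have hl : clim (fun m => B (v n) (u n) + -1 * B (v m) (u n)) (B (v n) (u n) + -1 * f (u n)).
  by apply: climD; [apply: clim_cst|apply: climZ].
rewrite mulN1r in hl; apply: (clim_norm_le hl); exists N1 => m m1; rewrite mulN1r -preipBl.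
apply/ltW/cs_lt; first lra.
have := h1 _ _ n1 m1; rewrite ltr_pdivlMr //.
have := uM _ nN; have := nsq_ge0 (psub (v n) (v m)); have := nsq_ge0 (u n); nra.
Qed.

Lemma rep_lim_indep v v' u u' f g c : rep v f -> rep v' f -> rep u g -> rep u' g ->
  clim (fun n => B (v n) (u n)) c -> clim (fun n => B (v' n) (u' n)) c.
Proof.
have half x x' y h d : rep x h -> rep x' h -> vcauchy y ->
    clim (fun n => B (x n) (y n)) d -> clim (fun n => B (x' n) (y n)) d.
  move=> rx rx' yc hd.
  have := climD (climZ (-1) (rep_diag rx yc)) (rep_diag rx' yc).
  rewrite mulr0 addr0 => /(climD hd); rewrite addr0; apply: clim_ext => n; ring.
move=> rv rv' ru ru' h; have h1 := half _ _ _ _ _ rv rv' (proj1 ru) h.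
have h2 : clim (fun n => B (u n) (v' n)) c^*.
  by apply: (clim_ext _ (climJ h1)) => n; rewrite -Bh.
have := climJ (half _ _ _ _ _ ru ru' (proj1 rv') h2).
by rewrite conjCK; apply: clim_ext => n; rewrite -Bh.
Qed.

(* The limit does not depend on the representing sequences, by [rep_lim_indep]. *)
Definition rip (f g : V -> C) : C :=
  xget 0 [set c | exists v u, [/\ rep v f, rep u g & clim (fun n => B (v n) (u n)) c]]%classic.

Lemma ripP v u f g : rep v f -> rep u g -> clim (fun n => B (v n) (u n)) (rip f g).
Proof.
move=> rv ru; have [c hc] := ccomplete (vcauchy_preip (proj1 rv) (proj1 ru)).
rewrite /rip; case: xgetP => [x _ [v' [u' [rv' ru' hx]]]|/(_ c)[]].
  exact: rep_lim_indep rv' rv ru' ru hx.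
by exists v, u.
Qed.

Lemma repZD a f g v u : rep v f -> rep u g ->
  rep (fun n => add (scl a (v n)) (u n)) (a *: f + g).
Proof.
move=> [vc vf] [uc ug]; split => [e e0|w]; last first.
  have -> : (a *: f + g) w = a * f w + g w by [].
  by apply: (clim_ext _ (climD (climZ a (vf w)) (ug w))) => n; rewrite Badd Bscl.
pose k := (normc a) ^+ 2; have k0 : 0 <= k by rewrite exprn_ge0 ?normc_ge0.
have [N h] := vc (e / (4 * (k + 1))) ltac:(by apply: divr_gt0; lra).
have [M g'] := uc (e / 4) ltac:(lra).
exists (maxn N M) => n m; rewrite !geq_max => /andP[n1 n2] /andP[m1 m2].
have := h _ _ n1 m1; rewrite ltr_pdivlMr; last lra.
have := g' _ _ n2 m2.
have := nsqD_le (scl a (psub (v n) (v m))) (psub (u n) (u m)).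
have -> : nsq (scl a (psub (v n) (v m))) = k * nsq (psub (v n) (v m)).
  by rewrite {1}/nsq Bscl preipZr mulrA normc_sqr ReMl.
have -> : nsq (add (scl a (psub (v n) (v m))) (psub (u n) (u m))) =
    nsq (psub (add (scl a (v n)) (u n)) (add (scl a (v m)) (u m))).
  by rewrite /nsq !(preipBl, preipBr, Badd, preipDr, Bscl, preipZr); congr (Re _); ring.
by have := nsq_ge0 (psub (v n) (v m)); nra.
Qed.

Lemma rep_cst u : rep (fun=> u) (B u).
Proof.
split=> [e e0|w]; last exact: clim_cst.
by exists 0%N => n m _ _; rewrite /nsq preipBl !preipBr !subrr.
Qed.

Hypothesis V0 : inhabited V.

Lemma rep0 : exists v, rep v 0.
Proof.
case: V0 => u; exists (fun=> scl 0 u).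
rewrite (_ : 0 = B (scl 0 u)); first exact: rep_cst.
by apply/funext => w; rewrite Bscl mul0r.
Qed.

Lemma compl_closed a f g : (exists v, rep v f) -> (exists v, rep v g) -> exists v, rep v (a *: f + g).
Proof. by move=> [v vf] [u ug]; eexists; exact: repZD vf ug. Qed.

Definition compl_sub := @Submodule R (V -> C : lmodType C) (fun f => exists v, rep v f) rep0 compl_closed.
Local Notation K := (smod compl_sub).
Definition cip (f g : K) : C := rip (smod_val f) (smod_val g).
Definition cin (u : V) : K := smod_of compl_sub (B u).

Lemma cinE u : smod_val (cin u) = B u.
Proof. by apply: smod_ofK; exists (fun=> u); exact: rep_cst. Qed.

(** The completion is a reproducing kernel space for [B]: the value of [f] at [u] is its inner
    product with [cin u]. *)
Lemma cip_cin u (f : K) : cip (cin u) f = (smod_val f u)^*.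
Proof.
have [v [vc vf]] := smodP f; apply: clim_uniq.
  by apply: (ripP _ (conj vc vf)); rewrite cinE; exact: rep_cst.
by apply: (clim_ext _ (climJ (vf u))) => n; rewrite -Bh.
Qed.

Lemma cip_inner : inner_product cip.
Proof.
split.
- move=> a f1 f2 g; have [v rv] := smodP f1; have [v2 rv2] := smodP f2.
  have [u ru] := smodP g; apply: (clim_uniq (ripP (repZD a rv rv2) ru)).
  apply: (clim_ext _ (climD (climZ a (ripP rv ru)) (ripP rv2 ru))) => n.
  by rewrite Badd Bscl.
- move=> f g; have [v rv] := smodP f; have [u ru] := smodP g.
  apply: (clim_uniq (ripP ru rv)).
  by apply: (clim_ext _ (climJ (ripP rv ru))) => n; rewrite -Bh.
- by move=> f; have [v rv] := smodP f; apply: (clim_ge0 (ripP rv rv)) => n.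
move=> f f0; have [v rv] := smodP f; apply: smod_inj; apply/funext => u.
have nv : clim (fun n => B (v n) (v n)) 0 by rewrite -f0; exact: ripP.
apply: (clim_uniq (proj2 rv u)) => e e0.
have [N h] := nv (e ^+ 2 / (nsq u + 1)) ltac:(apply: divr_gt0; [exact: exprn_gt0|have := nsq_ge0 u; lra]).
exists N => n /h; rewrite !subr0 ltr_pdivlMr; last by have := nsq_ge0 u; lra.
move=> h1; apply: cs_lt => //; apply: le_lt_trans h1.
have := Re_le_normc (B (v n) (v n)); rewrite -/(nsq _) ger0_norm ?nsq_ge0 // => h2.
by have := nsq_ge0 u; have := nsq_ge0 (v n); nra.
Qed.

Lemma cip_isom u v : cip (cin u) (cin v) = B u v.
Proof. by rewrite cip_cin cinE -Bh. Qed.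

Lemma cip_total (f : K) : (forall u, cip (cin u) f = 0) -> f = 0.
Proof.
move=> h; apply: smod_inj; apply/funext => u.
by rewrite -[LHS]conjCK -cip_cin h rmorph0.
Qed.

Lemma cip_dist_le v (f : K) w e : rep v (smod_val f) ->
  (exists N, forall n, (N <= n)%N -> nsq (psub (v n) w) <= e) ->
  Re (cip (f - cin w) (f - cin w)) <= e.
Proof.
move=> rv [N h]; apply: le_trans (ler_norm _) (le_trans (Re_le_normc _) _).
have r : rep (fun n => add (scl (-1) w) (v n)) (smod_val (f - cin w)).
  rewrite (_ : smod_val _ = -1 *: B w + smod_val f); first exact: repZD (rep_cst _) rv.
  by rewrite -cinE -smod_valZ -smod_valD scaleN1r addrC.
apply: (clim_norm_le (ripP r r)); exists N => n /h nN.
rewrite nsqE /= expr0n addr0 sqrtr_sqr ger0_norm ?nsq_ge0 //.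
suff <- : nsq (psub (v n) w) = nsq (add (scl (-1) w) (v n)) by [].
by rewrite /nsq !(preipBl, preipBr, Badd, preipDr, Bscl, preipZr) rmorphN rmorph1; congr (Re _); ring.
Qed.

Lemma cin_dense (f : K) e : 0 < e -> exists u, Re (cip (f - cin u) (f - cin u)) < e.
Proof.
move=> e0; have [v rv] := smodP f; have [N h] := rv.1 (e / 2) ltac:(lra).
exists (v N); suff : Re (cip (f - cin (v N)) (f - cin (v N))) <= e / 2 by lra.
by apply: (cip_dist_le rv); exists N => n nN; apply/ltW/h.
Qed.
End PreHilbert.

Section InnerProduct.
Variables (R : realType).
Local Notation C := R[i].
Local Notation Re := complex.Re.
Variables (V : lmodType C) (ip : V -> V -> C).
Hypothesis ipI : inner_product ip.

Lemma inner_preip : preip +%R *:%R ip.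
Proof.
case: ipI => il ih ip0 _; split => //.
- by move=> u v w; rewrite -[u]scale1r il mul1r scale1r.
- move=> c u w; have := il c u 0 w; rewrite addr0 => ->.
  suff -> : ip 0 w = 0 by rewrite addr0.
  have := il 1 0 0 w; rewrite scaler0 addr0 mul1r => h.
  by apply: (@addrI _ (ip 0 w)); rewrite addr0 -h.
Qed.

Lemma hnorm_lt x (e : R) : 0 < e -> (hnorm ip x < e%:C%C) = (Re (ip x x) < e ^+ 2).
Proof.
move=> e0; case: ipI => _ _ ip0 _.
have e0' : 0 <= e%:C%C by rewrite ler0c ltW.
rewrite -(@ltr_pXn2r _ 2) ?nnegrE ?sqrtC_ge0 ?ip0 //.
by rewrite /hnorm sqrtCK (ReE (ip0 x)) -rmorphXn ltcR.
Qed.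

Lemma hnorm_le x y : (hnorm ip x <= hnorm ip y) = (Re (ip x x) <= Re (ip y y)).
Proof.
case: ipI => _ _ ip0 _.
rewrite -(@ler_pXn2r _ 2) ?nnegrE ?sqrtC_ge0 ?ip0 //.
by rewrite /hnorm !sqrtCK (ReE (ip0 x)) (ReE (ip0 y)) lecR.
Qed.

Lemma complexR_gt0 (e : C) : 0 < e -> exists2 r : R, 0 < r & e = r%:C%C.
Proof.
move=> e0; exists (Re e); last by rewrite -ReE // ltW.
by move: (e0); rewrite {1}(ReE (ltW e0)) ltcR.
Qed.

Lemma hilbertP : hilbert ip <->
  forall u, vcauchy +%R *:%R ip u ->
    exists l, forall e : R, 0 < e -> exists N, forall n, (N <= n)%N -> Re (ip (u n - l) (u n - l)) < e.
Proof.
split => [[_ h] u uc|h].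
  have [_ /complexR_gt0[e e0 ->]|l hl] := h u.
    have [N hN] := uc (e ^+ 2) ltac:(exact: exprn_gt0).
    exists N => n p nN pN; rewrite hnorm_lt //.
    by have := hN _ _ nN pN; rewrite /nsq /psub scaleN1r.
  exists l => e e0; have s0 : 0 < Num.sqrt e by rewrite sqrtr_gt0.
  have [N hN] := hl (Num.sqrt e)%:C%C ltac:(by rewrite ltcR).
  by exists N => n /hN; rewrite hnorm_lt // sqr_sqrtr // ltW.
split=> // u uc; have [e e0|l hl] := h u.
  have s0 : 0 < Num.sqrt e by rewrite sqrtr_gt0.
  have [N hN] := uc (Num.sqrt e)%:C%C ltac:(by rewrite ltcR).
  exists N => n p nN pN; have := hN _ _ nN pN.
  by rewrite hnorm_lt // sqr_sqrtr ?ltW // /nsq /psub scaleN1r.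
exists l => _ /complexR_gt0[e e0 ->].
have [N hN] := hl (e ^+ 2) ltac:(exact: exprn_gt0).
by exists N => n /hN; rewrite hnorm_lt.
Qed.
End InnerProduct.

Lemma inv_nat_lt (R : realType) (e : R) : 0 < e ->
  exists N, forall n, (N <= n)%N -> n.+1%:R^-1 < e.
Proof.
move=> e0; exists (Num.bound e^-1) => n Nn.
have h : e^-1 < n.+1%:R.
  apply: lt_le_trans (archi_boundP _) _; first by rewrite invr_ge0 ltW.
  by rewrite ler_nat leqW.
by rewrite -[e]invrK ltf_pV2 ?posrE ?invr_gt0 // ltr0n.
Qed.

Section Completion.
Variables (R : realType).
Local Notation C := R[i].
Local Notation Re := complex.Re.
Variables (V : Type) (add : V -> V -> V) (scl : C -> V -> V) (B : V -> V -> C).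
Hypothesis Bpre : preip add scl B.
Hypothesis V0 : inhabited V.
Local Notation K := (smod (compl_sub Bpre V0)).
Local Notation cip := (@cip _ _ _ _ _ Bpre V0).
Local Notation cin := (cin Bpre V0).

Lemma nsq_cin u v : Re (cip (cin u - cin v) (cin u - cin v)) = nsq B (psub add scl u v).
Proof.
have Kpre := inner_preip (cip_inner Bpre V0).
have := preipBl Kpre; have := preipBr Kpre; rewrite /psub => hr hl.
rewrite -[- cin v]scaleN1r hl !hr !cip_isom /nsq.
by rewrite (preipBl Bpre) !(preipBr Bpre).
Qed.

(** Each [u n] is replaced by some [cin (v n)] at squared distance below [1 / (n + 1)]; then [v] is
    Cauchy in [V], and the functional it represents is the limit of [u]. *)
Lemma cip_hilbert : hilbert cip.
Proof.
have Ki := cip_inner Bpre V0; have Kpre := inner_preip Ki.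
apply/(hilbertP Ki) => u uc.
have hd n : exists w, Re (cip (u n - cin w) (u n - cin w)) < n.+1%:R^-1.
  by apply: cin_dense; rewrite invr_gt0 ltr0n.
have [v hv] := choice hd.
pose N2 x := Re (cip x x).
have tri w x y : N2 (x - y) <= 2 * N2 (x - w) + 2 * N2 (w - y).
  by have := nsq_triangle Kpre w x y; rewrite /nsq /psub !scaleN1r.
have N2s x y : N2 (x - y) = N2 (y - x).
  by have := nsq_psub_sym Kpre x y; rewrite /nsq /psub !scaleN1r.
have vc : vcauchy add scl B v.
  move=> e e0; have [N h] := uc (e / 8) ltac:(lra).
  have [N' h'] := @inv_nat_lt R (e / 16) ltac:(lra).
  exists (maxn N N') => n m; rewrite !geq_max => /andP[n1 n2] /andP[m1 m2].
  rewrite -nsq_cin -/(N2 _).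
  have t1 := tri (u n) (cin (v n)) (cin (v m)); have t2 := tri (u m) (u n) (cin (v m)).
  have t3 : N2 (u n - u m) < e / 8 by have := h _ _ n1 m1; rewrite /nsq /psub scaleN1r.
  have t4 : N2 (cin (v n) - u n) < e / 16 by rewrite N2s; exact: lt_trans (hv n) (h' _ n2).
  have t5 : N2 (u m - cin (v m)) < e / 16 by exact: lt_trans (hv m) (h' _ m2).
  lra.
have hf w : exists c, clim (fun n => B (v n) w) c.
  apply: ccomplete; apply: (vcauchy_preip Bpre) => //.
  by move=> e e0; exists 0%N => n m _ _; rewrite /nsq (preipBl Bpre) subrr.
have [f fv] := choice hf.
have rf : rep add scl B v f by [].
have fK : smod_val (smod_of (compl_sub Bpre V0) f) = f by apply: smod_ofK; exists v.
exists (smod_of (compl_sub Bpre V0) f) => e e0.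
have [N h] := vc (e / 8) ltac:(lra).
have [N' h'] := @inv_nat_lt R (e / 8) ltac:(lra).
exists (maxn N N') => n; rewrite geq_max => /andP[n1 n2].
set g := smod_of _ f.
have t1 : N2 (g - cin (v n)) <= e / 8.
  apply: (@cip_dist_le _ _ _ _ _ Bpre V0 v); first by rewrite fK.
  by exists N => m m1; apply/ltW/h.
have t2 := tri (cin (v n)) (u n) g; rewrite (N2s (cin (v n)) g) in t2.
have t3 : N2 (u n - cin (v n)) < e / 8 by exact: lt_trans (hv n) (h' _ n2).
change (N2 (u n - g) < e); lra.
Qed.

Section Lift.
Variables (S S' : V -> V).
Hypothesis Sadj : forall u v, B (S u) v = B u (S' v).
Hypothesis Siso : forall u v, B (S u) (S v) = B u v.

Lemma rep_lift v f : rep add scl B v f -> rep add scl B (S \o v) (f \o S').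
Proof.
move=> [vc vf]; split=> [e e0|w]; last by apply: (clim_ext _ (vf (S' w))) => n /=.
have [N h] := vc e e0; exists N => n m nN mN; have := h _ _ nN mN.
by rewrite /nsq !(preipBl Bpre, preipBr Bpre) /= !Siso.
Qed.

(** Extends [S], although only the adjoint [S'] occurs: if [f] is the limit of [B (v n)], then
    [f \o S'] is the limit of [B (S (v n))]. *)
Definition clift (f : K) : K := smod_of (compl_sub Bpre V0) (smod_val f \o S').

Lemma cliftE f : smod_val (clift f) = smod_val f \o S'.
Proof. by apply: smod_ofK; have [v rv] := smodP f; exists (S \o v); exact: rep_lift. Qed.

Lemma clift_linear : linear clift.
Proof. by move=> a f g; apply: smod_inj; rewrite smod_valD smod_valZ !cliftE. Qed.

Lemma clift_cin u : clift (cin u) = cin (S u).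
Proof.
by apply: smod_inj; rewrite cliftE !cinE; apply/funext => w /=; rewrite Sadj.
Qed.

Lemma cip_clift f g : cip (clift f) (clift g) = cip f g.
Proof.
have [v rv] := smodP f; have [u ru] := smodP g.
have rv' : rep add scl B (S \o v) (smod_val (clift f)) by rewrite cliftE; exact: rep_lift.
have ru' : rep add scl B (S \o u) (smod_val (clift g)) by rewrite cliftE; exact: rep_lift.
apply: (clim_uniq (ripP Bpre rv' ru')).
by apply: (clim_ext _ (ripP Bpre rv ru)) => n /=.
Qed.
End Lift.

Lemma cliftK S S' : (forall u v, B (S u) v = B u (S' v)) ->
  (forall u v, B (S u) (S v) = B u v) -> (forall u v, B (S' u) (S' v) = B u v) ->
  cancel (clift S') (clift S).
Proof.
move=> Sadj Siso S'iso f; apply: smod_inj.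
have S'adj u v : B (S' u) v = B u (S v) by rewrite (preipJ Bpre) -Sadj -(preipJ Bpre).
rewrite (cliftE S'adj) // (cliftE Sadj) //.
apply/funext => w /=; have [v [vc vf]] := smodP f.
apply: (clim_uniq (vf _)); apply: (clim_ext _ (vf w)) => n.
by rewrite -Sadj Siso.
Qed.
End Completion.

(* [K] is realised as the functions [u |-> lim B (v n) u] on [V], with [v] ranging over the
   [B]-Cauchy sequences: neither a quotient by the null space nor linearity of [V] is needed. *)
Theorem completion (R : realType) (V : Type) (add : V -> V -> V) (scl : R[i] -> V -> V)
    (B : V -> V -> R[i]) (A : Type) (S S' : A -> V -> V) :
  preip add scl B -> inhabited V ->
  (forall a u v, B (S a u) v = B u (S' a v)) ->
  (forall a u v, B (S a u) (S a v) = B u v) ->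
  (forall a u v, B (S' a u) (S' a v) = B u v) ->
  exists (K : lmodType R[i]) (ip : K -> K -> R[i]) (i : V -> K) (U U' : A -> K -> K),
    hilbert ip /\ (forall u v, ip (i u) (i v) = B u v) /\
    (forall f, (forall u, ip (i u) f = 0) -> f = 0) /\
    (forall a, linear (U a)) /\ (forall a f g, ip (U a f) g = ip f (U' a g)) /\
    (forall a, cancel (U a) (U' a)) /\ (forall a, cancel (U' a) (U a)) /\
    (forall a u, U a (i u) = i (S a u)).
Proof.
move=> Bpre V0 Sadj Siso S'iso.
have S'adj a u v : B (S' a u) v = B u (S a v) by rewrite (preipJ Bpre) -Sadj -(preipJ Bpre).
exists (smod (compl_sub Bpre V0)), (@cip _ _ _ _ _ Bpre V0), (cin Bpre V0).
exists (fun a => @clift _ _ _ _ _ Bpre V0 (S' a)), (fun a => @clift _ _ _ _ _ Bpre V0 (S a)).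
have c1 a : cancel (@clift _ _ _ _ _ Bpre V0 (S' a)) (@clift _ _ _ _ _ Bpre V0 (S a)) by exact: cliftK.
have c2 a : cancel (@clift _ _ _ _ _ Bpre V0 (S a)) (@clift _ _ _ _ _ Bpre V0 (S' a)) by exact: cliftK.
split; first exact: cip_hilbert.
split; first exact: cip_isom.
split; first exact: cip_total.
split; first by move=> a; exact: (clift_linear (Sadj a) (Siso a)).
split; first by move=> a f g; rewrite -{1}(c2 a g) (cip_clift (Sadj a) (Siso a)).
split; first exact: c1.
split; first exact: c2.
by move=> a u; exact: clift_cin.
Qed.

(** * The Riesz representation theorem and adjoints *)

Section Riesz.
Variables (R : realType).
Local Notation C := R[i].
Local Notation Re := complex.Re.
Local Notation Im := complex.Im.
Variables (V : lmodType C) (ip : V -> V -> C).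
Hypothesis ipH : hilbert ip.
Let ipI : inner_product ip := proj1 ipH.
Let ipP : preip +%R *:%R ip := inner_preip ipI.

(** The representing vector minimises [f x = |x|^2 - 2 Re (phi x)], which is at least [- M] because
    [2 |phi x| <= |x|^2 + M]. The parallelogram law makes every minimising sequence Cauchy. *)
Lemma riesz (phi : V -> C) (M : R) :
  (forall a x y, phi (a *: x + y) = a * phi x + phi y) -> 0 <= M ->
  (forall x, normc (phi x) ^+ 2 <= M * Re (ip x x)) -> exists z, forall x, phi x = ip x z.
Proof.
move=> phil M0 phib.
have phiD x y : phi (x + y) = phi x + phi y by rewrite -[x]scale1r phil mul1r scale1r.
have phi0 : phi 0 = 0 by apply: (@addrI _ (phi 0)); rewrite -phiD !addr0.
have phiZ a x : phi (a *: x) = a * phi x by rewrite -[a *: x]addr0 phil phi0 addr0.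
pose n x : R := nsq ip x; have n0 x : 0 <= n x by apply: (nsq_ge0 ipP).
pose f x := n x - 2 * Re (phi x).
have fM x : - M <= f x.
  have h := phib x; have := n0 x; have := normc_ge0 (phi x); have := le_trans (ler_norm _) (Re_le_normc (phi x)).
  rewrite /f; change (Re (ip x x)) with (n x) in h.
  move: (normc _) h => p h rp p0 nx0; suff : 2 * p <= n x + M by lra.
  have hs : p ^+ 2 * 4 <= (n x + M) ^+ 2 by have := sqr_ge0 (n x - M); nra.
  by rewrite leNgt; apply/negP => hl; nra.
have nE x y : n (x - y) = 2 * f x + 2 * f y - 4 * f (2^-1%:C%C *: (x + y)).
  have := parallelogram ipP x y; rewrite /psub scaleN1r -/(n _) -/(n (x - y)) -/(n x) -/(n y).
  rewrite /f phiZ phiD ReMl ReD.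
  have -> : n (2^-1%:C%C *: (x + y)) = 4^-1 * n (x + y).
    rewrite /n /nsq (preipZ ipP) (preipZr ipP) conjCR !ReMl; field; lra.
  by lra.
pose A := [set f x | x in [set: V]]%classic.
have hA : has_inf A.
  split; [by exists (f 0), 0|exists (- M)]; apply/lbP => z [w _ <-]; exact: fM.
pose m := inf A.
have mf x : m <= f x.
  by apply: ge_inf; [exact: hA.2|exists x].
have hx k : exists x, f x < m + k.+1%:R^-1.
  have k0 : 0 < k.+1%:R^-1 :> R by rewrite invr_gt0 ltr0n.
  by have [_ [y _ <-] hy] := inf_adherent k0 hA; exists y.
have [x xm] := choice hx.
have [|l hl] := (hilbertP ipI).1 ipH x.
  move=> e e0; have [N h] := @inv_nat_lt R (e / 4) ltac:(lra).
  exists N => p k Np Nk; rewrite /psub scaleN1r -/(n _) nE.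
  have hp : f (x p) < m + e / 4 by apply: lt_trans (xm p) _; rewrite ltrD2l h.
  have hk : f (x k) < m + e / 4 by apply: lt_trans (xm k) _; rewrite ltrD2l h.
  by have := mf (2^-1%:C%C *: (x p + x k)); lra.
pose g h := Re (ip h l - phi h).
(* [2 * g h + n h] is the limit of [f (x k + h) - f (x k)], which is at least [m - f (x k)].
   Rescaling [h] by a small positive real then removes the quadratic term, and replacing [h] by
   [- h] turns the inequality into an equality. *)
have gn h : 0 <= 2 * g h + n h.
  rewrite leNgt; apply/negP => d0; set d := 2 * g h + n h in d0.
  have [N hN] := @inv_nat_lt R (- d / 4) ltac:(lra).
  have [N' hN'] := hl ((- d / 4) ^+ 2 / (n h + 1)) ltac:(by apply: divr_gt0; [apply: exprn_gt0; lra|have := n0 h; lra]).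
  pose k := maxn N N'.
  have e1 : f (x k) < m + - d / 4 by apply: lt_trans (xm k) _; rewrite ltrD2l hN // leq_maxl.
  have := hN' k (leq_maxr N N'); rewrite ltr_pdivlMr; last by have := n0 h; lra.
  rewrite -[Re _]/(n (x k - l)) => e2.
  have : normc (ip h (x k - l)) < - d / 4.
    apply: (cs_lt ipP); first lra.
    by apply: le_lt_trans e2; rewrite mulrDr mulr1 mulrC lerDl n0.
  have := le_trans (ler_norm _) (Re_le_normc (ip h (x k - l))).
  have -> : ip h (x k - l) = ip h (x k) - ip h l.
    by have := preipBr ipP (x k) l h; rewrite /psub scaleN1r.
  rewrite ReD ReN.
  have := mf (x k + h); move: e1; rewrite /f phiD ReD.
  have -> : n (x k + h) = n (x k) + 2 * Re (ip h (x k)) + n h.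
    rewrite /n /nsq !(preipD ipP, preipDr ipP) (preipJ ipP h (x k)) !ReD ReJ; lra.
  by move: d0; rewrite /d /g ReD ReN; lra.
have gZ (t : R) h : g (t%:C%C *: h) = t * g h.
  by rewrite /g phiZ (preipZ ipP) -mulrBr ReMl.
have g0 h : 0 <= g h.
  rewrite leNgt; apply/negP => gh; have nh := n0 h.
  pose t := - g h / (n h + 1).
  have t0 : 0 < t by apply: divr_gt0; lra.
  have tn : t * (n h + 1) = - g h by rewrite /t; field; lra.
  have := gn (t%:C%C *: h); rewrite gZ.
  have -> : n (t%:C%C *: h) = t ^+ 2 * n h.
    by rewrite /n /nsq (preipZ ipP) (preipZr ipP) conjCR !ReMl; ring.
  by nra.
have gE h : g h = 0.
  by have := g0 h; have := g0 ((-1)%:C%C *: h); rewrite gZ; lra.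
exists l => h; apply/esym/eqP; rewrite -subr_eq0; apply/eqP.
(* [gE] controls real parts only; its instance at ['i *: h] supplies the imaginary part. *)
have := gE h; have := gE ('i%C *: h); rewrite /g phiZ (preipZ ipP) -mulrBr mulrC ReiNIm.
by case: (_ - _) => a b /= b0 ->; congr (Complex _ _); lra.
Qed.
End Riesz.

Section Adjoint.
Variables (R : realType).
Local Notation C := R[i].
Local Notation Re := complex.Re.
Variables (V W : lmodType C) (ipV : V -> V -> C) (ipW : W -> W -> C).

Lemma inner_ext (x y : V) : inner_product ipV -> (forall z, ipV z x = ipV z y) -> x = y.
Proof.
move=> ipI h; have P := inner_preip ipI; case: ipI => _ _ _ h0.
apply/eqP; rewrite -subr_eq0; apply/eqP/h0.
by have := preipBr P x y (x - y); rewrite /psub scaleN1r h subrr.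
Qed.

Lemma hadj_unique (T : V -> W) (S : W -> V) : inner_product ipV ->
  (forall x y, ipW (T x) y = ipV x (S y)) -> hadj ipV ipW T = S.
Proof.
move=> ipI hS; apply/funext => y; apply: inner_ext => // z; rewrite -hS.
by symmetry; apply: (ClassicalEpsilon.epsilon_spec
  (inhabits (fun _ : W => 0 : V)) (fun S : W -> V => forall x y, ipW (T x) y = ipV x (S y))); exists S.
Qed.

Lemma hadjP (T : V -> W) : hilbert ipV -> inner_product ipW -> linear T ->
  (forall x, Re (ipW (T x) (T x)) <= Re (ipV x x)) ->
  forall x y, ipW (T x) y = ipV x (hadj ipV ipW T y).
Proof.
move=> hV iW Tl Tb; have PW := inner_preip iW.
have ex y : exists z, forall x, ipW (T x) y = ipV x z.
  apply: (riesz hV (M := nsq ipW y)).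
  - by move=> a u v; rewrite Tl (preipD PW) (preipZ PW).
  - exact: (nsq_ge0 PW).
  move=> x; apply: le_trans (cauchy_schwarz PW _ _) _.
  by rewrite mulrC ler_wpM2l ?(nsq_ge0 PW) // Tb.
have [S hS] := choice ex.
by rewrite (hadj_unique (S := S)) //; exact: hV.1.
Qed.
End Adjoint.

(** * Words in q-commuting operators *)

Section LinearMaps.
Variables (R : realType) (V W : lmodType R[i]).
Implicit Types (f : V -> W) (c : R[i]).
Lemma linear_scale f c x : linear f -> f (c *: x) = c *: f x.
Proof.
move=> fl; have f0 : f 0 = 0.
  by have := fl 1 0 0; rewrite !scale1r addr0 => h; apply: (@addrI _ (f 0)); rewrite addr0 -h.
by have := fl c x 0; rewrite addr0 f0 addr0.
Qed.
Lemma linear_add f x y : linear f -> f (x + y) = f x + f y.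
Proof. by move=> fl; have := fl 1 x y; rewrite !scale1r. Qed.
Lemma linear_sub f x y : linear f -> f (x - y) = f x - f y.
Proof. by move=> fl; rewrite -scaleN1r linear_add // linear_scale // scaleN1r. Qed.
End LinearMaps.

Section QCommutation.
Variables (R : realType).
Local Notation C := R[i].
Variable (V : lmodType C).
Implicit Types (f g : V -> V) (c : C).

Definition qcomm c f g := forall x, f (g x) = c *: g (f x).

Lemma linear_iter f n : linear f -> linear (iter n f).
Proof. by move=> fl; elim: n => [//|n IH] a x y /=; rewrite IH fl. Qed.
Lemma linear_inverse f g : linear f -> cancel f g -> cancel g f -> linear g.
Proof. by move=> fl fK gK a x y; rewrite -{1}(gK x) -{1}(gK y) -fl fK. Qed.

Lemma qcomm_iterr c f g n : linear g -> qcomm c f g -> qcomm (c ^+ n) f (iter n g).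
Proof.
move=> gl h; elim: n => [|n IH] x /=; first by rewrite scale1r.
by rewrite h IH linear_scale // scalerA exprS.
Qed.
Lemma qcomm_iterl c f g n : linear f -> qcomm c f g -> qcomm (c ^+ n) (iter n f) g.
Proof.
move=> fl h; elim: n => [|n IH] x /=; first by rewrite scale1r.
by rewrite IH linear_scale // h scalerA exprSr.
Qed.
Lemma qcomm_invr c f g g' : c != 0 -> linear g -> cancel g g' -> cancel g' g ->
  qcomm c f g -> qcomm c^-1 f g'.
Proof.
move=> c0 gl gK g'K h x; rewrite -[LHS]gK; have g'l := linear_inverse gl gK g'K.
by rewrite -(linear_scale _ _ g'l); congr (g' _); rewrite -{2}(g'K x) h scalerA mulVf // scale1r.
Qed.
Lemma qcomm_invl c f g f' : c != 0 -> linear f -> cancel f f' -> cancel f' f ->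
  qcomm c f g -> qcomm c^-1 f' g.
Proof.
move=> c0 fl fK f'K h x; have f'l := linear_inverse fl fK f'K.
by rewrite -{1}(f'K x) -[g (f (f' x))]scale1r -(mulVf c0) -scalerA -h linear_scale // fK.
Qed.
End QCommutation.

Section Words.
Variables (R : realType) (L : Type) (q : L -> L -> R[i]).
Local Notation C := R[i].
Hypothesis qU : unimodular_q q.

Lemma q_neq0 a b : a <> b -> q a b != 0.
Proof. by move=> /qU[h _]; rewrite -normr_eq0 h oner_neq0. Qed.

Section Actions.
Variable (V : lmodType C).
Implicit Types (U Ui : L -> V -> V).

(** Only the operators indexed by [s] are invertible; elsewhere [Ui] is arbitrary. The same notion
    thus serves the full dilation and every intermediate stage. *)
Record qsys (s : L -> Prop) U Ui : Prop := QSys {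
  qsys_linear : forall a, linear (U a);
  qsysK : forall a, s a -> cancel (U a) (Ui a);
  qsysVK : forall a, s a -> cancel (Ui a) (U a);
  qsys_comm : q_commuting q U }.

Definition letter U Ui (p : L * bool) := if p.2 then U p.1 else Ui p.1.
Definition act U Ui (w : seq (L * bool)) x := foldr (letter U Ui) x w.
Definition zpow U Ui a (m : int) : V -> V :=
  match m with Posz n => iter n (U a) | Negz n => iter n.+1 (Ui a) end.
Definition oact U Ui (l : seq (L * int)) x := foldr (fun p => zpow U Ui p.1 p.2) x l.
Definition pact (F : L -> V -> V) (l : seq (L * nat)) x := foldr (fun p => iter p.2 (F p.1)) x l.

Variables (s : L -> Prop) (U Ui : L -> V -> V).
Hypothesis sys : qsys s U Ui.

Lemma qsys_linearV a : s a -> linear (Ui a).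
Proof. by move=> sa; apply: (linear_inverse (qsys_linear sys a)); [apply: (qsysK sys)|apply: (qsysVK sys)]. Qed.

Lemma letter_linear p : s p.1 -> linear (letter U Ui p).
Proof. by rewrite /letter; case: p.2 => sp; [apply: (qsys_linear sys)|apply: qsys_linearV]. Qed.

Lemma pact_linear (F : L -> V -> V) l : (forall p, List.In p l -> linear (F p.1)) -> linear (pact F l).
Proof.
elim: l => [|p l IH] h a x y //=.
have hp : linear (iter p.2 (F p.1)) by apply/linear_iter/h; left.
by rewrite IH ?hp // => r rl; apply: h; right.
Qed.

Lemma qsys_UUi a b : a <> b -> s b -> qcomm (q a b)^-1 (U a) (Ui b).
Proof.
move=> ab sb; apply: (qcomm_invr (q_neq0 ab) (qsys_linear sys b)).
- exact: (qsysK sys).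
- exact: (qsysVK sys).
- exact: (qsys_comm sys).
Qed.
Lemma qsys_UiU a b : a <> b -> s a -> qcomm (q a b)^-1 (Ui a) (U b).
Proof.
move=> ab sa; apply: (qcomm_invl (q_neq0 ab) (qsys_linear sys a)).
- exact: (qsysK sys).
- exact: (qsysVK sys).
- exact: (qsys_comm sys).
Qed.
Lemma qsys_UiUi a b : a <> b -> s a -> s b -> qcomm (q a b) (Ui a) (Ui b).
Proof.
move=> ab sa sb; rewrite -[q a b]invrK.
apply: (qcomm_invr _ (qsys_linear sys b)); first by rewrite invr_eq0 q_neq0.
- exact: (qsysK sys).
- exact: (qsysVK sys).
- exact: qsys_UiU.
Qed.

Lemma zpowS a m x : s a -> U a (zpow U Ui a m x) = zpow U Ui a (m + 1) x.
Proof.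
move=> sa; case: m => [n|[|n]]; first by rewrite -PoszD addn1.
  by rewrite /= (qsysVK sys).
have -> : Negz n.+1 + 1 = Negz n by lia.
by rewrite /= (qsysVK sys).
Qed.
Lemma zpowV a m x : s a -> Ui a (zpow U Ui a m x) = zpow U Ui a (m - 1) x.
Proof.
move=> sa; case: m => [[|n]|n] //; first by rewrite /= (qsysK sys) //; congr (iter _ _ _); lia.
have -> : Negz n - 1 = Negz n.+1 by lia.
by [].
Qed.
Lemma zpow_split a m x : zpow U Ui a m x = iter (mminus m) (Ui a) (iter (mplus m) (U a) x).
Proof. by case: m. Qed.
End Actions.

(** This is [q p.1 b] to the power [m] or [- m] according to the sign of the letter: passing to the
    inverse on either side inverts the scalar. *)
Definition letter_phase (p : L * bool) b (m : int) : C :=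
  let c := if p.2 (+) (match m with Posz _ => true | _ => false end) then (q p.1 b)^-1 else q p.1 b in
  c ^+ (match m with Posz n => n | Negz n => n.+1 end).

Lemma letter_zpow (V : lmodType C) s (U Ui : L -> V -> V) p b m : qsys s U Ui ->
  s p.1 -> s b -> p.1 <> b -> qcomm (letter_phase p b m) (letter U Ui p) (zpow U Ui b m).
Proof.
move=> sys; case: p => a e /= sa sb ab.
have Ul := qsys_linear sys b; have Uil := qsys_linearV sys sb.
case: m => n; rewrite /letter_phase /letter /=; case: e => /=; apply: qcomm_iterr => //.
- exact: (qsys_comm sys).
- exact: (qsys_UiU sys).
- exact: (qsys_UUi sys).
- exact: (qsys_UiUi sys).
Qed.

(** The letter travels to the right, collecting a phase at each foreign index, until the exponent of
    its own index absorbs it or it becomes a new last factor. *)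
Lemma letter_insert (p : L * bool) (l : seq (L * int)) : List.NoDup [seq r.1 | r <- l] ->
  exists c l', List.NoDup [seq r.1 | r <- l'] /\
    (forall b, List.In b [seq r.1 | r <- l'] -> b = p.1 \/ List.In b [seq r.1 | r <- l]) /\
    forall (V : lmodType C) s (U Ui : L -> V -> V), qsys s U Ui -> s p.1 ->
      (forall b, List.In b [seq r.1 | r <- l] -> s b) ->
      forall x, letter U Ui p (oact U Ui l x) = c *: oact U Ui l' x.
Proof.
elim: l => [_|[b m] l IH /= /List.NoDup_cons_iff[bl ndl]].
  exists 1, [:: (p.1, if p.2 then 1 else -1 : int)]; split; first by constructor => //; constructor.
  split; first by move=> b [<-|//]; left.
  by move=> V s U Ui _ _ _ x; rewrite scale1r /letter /=; case: p.2.
have [pb|pb] := pselect (p.1 = b).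
  exists 1, ((b, if p.2 then m + 1 else m - 1) :: l); split; first exact/List.NoDup_cons_iff.
  split; first by move=> d dl; right.
  move=> V s U Ui sys sp sl x; rewrite scale1r /letter /= pb.
  by case: p.2; [rewrite (zpowS sys) // -pb|rewrite (zpowV sys) // -pb].
have [c [l' [nd [il h]]]] := IH ndl.
exists (letter_phase p b m * c), ((b, m) :: l'); split.
  by apply/List.NoDup_cons_iff; split=> //= /il[/esym|].
split; first by move=> d /= [<-|/il[->|dl]]; [right; left|left|right; right].
move=> V s U Ui sys sp sl x /=.
rewrite (letter_zpow m sys sp (sl b (or_introl erefl)) pb) (h _ _ _ _ sys) //; last by move=> d dl; apply: sl; right.
rewrite -scalerA; congr (_ *: _); apply: linear_scale.
have sb : s b by apply: sl; left.
by case: (m) => n; apply: linear_iter; [apply: (qsys_linear sys)|apply: (qsys_linearV sys)].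
Qed.

(* [c] and [l] depend only on [w] and [q], not on the operators: this makes the values of a
   regular dilation on words unique. *)
Lemma word_normal (w : seq (L * bool)) :
  exists c l, List.NoDup [seq r.1 | r <- l] /\
    (forall b, List.In b [seq r.1 | r <- l] -> List.In b [seq r.1 | r <- w]) /\
    forall (V : lmodType C) s (U Ui : L -> V -> V), qsys s U Ui ->
      (forall b, List.In b [seq r.1 | r <- w] -> s b) ->
      forall x, act U Ui w x = c *: oact U Ui l x.
Proof.
elim: w => [|p w [c [l [nd [il h]]]]].
  exists 1, [::]; split; first by constructor.
  by split => // V s U Ui _ _ x; rewrite scale1r.
have [c' [l' [nd' [il' h']]]] := letter_insert p nd.
exists (c * c'), l'; split => //; split; first by move=> b /il'[->|/il]; [left|right].
move=> V s U Ui sys sw x /=; have sp : s p.1 by apply: sw; left.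
rewrite (h _ _ _ _ sys); last by move=> b bw; apply: sw; right.
rewrite linear_scale; last exact: (letter_linear sys).
rewrite (h' _ _ _ _ sys) ?scalerA // => b /il bw; apply: sw; right; exact: bw.
Qed.

(** The scalar of the regular dilation identity, arranged as a recursion on the list of
    exponents. *)
Fixpoint phase (l : seq (L * int)) : C :=
  if l is p :: l' then
    (\prod_(r <- l') q p.1 r.1 ^ (- ((mplus p.2 * mminus r.2)%N : int))) * phase l'
  else 1.

Definition posl (l : seq (L * int)) : seq (L * nat) := [seq (p.1, mplus p.2) | p <- l].
Definition negl (l : seq (L * int)) : seq (L * nat) := [seq (p.1, mminus p.2) | p <- l].

Lemma In_negl p l : List.In p (negl l) -> exists2 r, List.In r l & p = (r.1, mminus r.2).
Proof.
by elim: l => //= r l IH [<-|/IH[r' r'l ->]]; [exists r; first by left|exists r' => //; right].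
Qed.
Lemma In_posl p l : List.In p (posl l) -> exists2 r, List.In r l & p = (r.1, mplus r.2).
Proof.
by elim: l => //= r l IH [<-|/IH[r' r'l ->]]; [exists r; first by left|exists r' => //; right].
Qed.
Lemma In_fst (A : Type) (p : L * A) l : List.In p l -> List.In p.1 [seq r.1 | r <- l].
Proof. by elim: l => //= r l IH [->|/IH]; [left|right]. Qed.
Lemma NoDup_fst_inj (A : Type) (l : seq (L * A)) a x y : List.NoDup [seq r.1 | r <- l] ->
  List.In (a, x) l -> List.In (a, y) l -> x = y.
Proof.
elim: l => //= -[b z] l IH /= /List.NoDup_cons_iff[bl nd] h1 h2.
case: h1 h2 => [[ba zx]|h1] [[ba' zy]|h2]; last exact: IH.
- by rewrite -zx.
- by case: bl; rewrite ba; apply: (In_fst h2).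
- by case: bl; rewrite ba'; apply: (In_fst h1).
Qed.

(** Explains the scalar in the definition of regularity: gathering all inverse powers on the left
    moves [U a ^ m] past [Ui b ^ n], at the cost of [q a b ^ (- (m n))], for each [a] that precedes
    [b]. *)
Lemma oact_split (V : lmodType C) s (U Ui : L -> V -> V) l x : qsys s U Ui ->
  List.NoDup [seq r.1 | r <- l] -> (forall b, List.In b [seq r.1 | r <- l] -> s b) ->
  oact U Ui l x = phase l *: pact Ui (negl l) (pact U (posl l) x).
Proof.
move=> sys; elim: l => [|[a m] l IH] /=; first by rewrite scale1r.
move=> /List.NoDup_cons_iff[al nd] sl.
have sa : s a by apply: sl; left.
have sl' b : List.In b [seq r.1 | r <- l] -> s b by move=> bl; apply: sl; right.
rewrite IH // zpow_split.
have Ul n : linear (iter n (U a)) by apply/linear_iter/(qsys_linear sys).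
have Uil n : linear (iter n (Ui a)) by apply/linear_iter/(qsys_linearV sys).
have mv y : iter (mplus m) (U a) (pact Ui (negl l) y) =
    (\prod_(r <- l) q a r.1 ^ (- ((mplus m * mminus r.2)%N : int))) *:
      pact Ui (negl l) (iter (mplus m) (U a) y).
  elim: (l) al sl' {IH nd sl} => [|[b n] l' IH'] /= al sl'; first by rewrite big_nil scale1r.
  have ab : a <> b by move=> ab; apply: al; left.
  have sb : s b by apply: sl'; left.
  have := qcomm_iterl (mplus m) (qsys_linear sys a) (qcomm_iterr (mminus n) (qsys_linearV sys sb) (qsys_UUi sys ab sb)).
  move=> ->; rewrite IH' => [|bl|d dl]; last 2 first.
  - by apply: al; right.
  - by apply: sl'; right.
  rewrite linear_scale; last exact/linear_iter/(qsys_linearV sys).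
  rewrite scalerA big_cons; congr (_ * _ *: _).
  by rewrite -exprM mulnC exprVn -exprnN.
by rewrite (linear_scale _ _ (Ul _)) mv !(linear_scale _ _ (Uil _)) scalerA [phase l * _]mulrC.
Qed.

End Words.

(** * Defect forms and regularity *)

Section Defect.
Variables (R : realType) (L : Type) (q : L -> L -> R[i]).
Local Notation C := R[i].
Local Notation Re := complex.Re.
Hypothesis qU : unimodular_q q.

(* [defect B F t x x] is [<S(t) x, x>], since [S(a, t) = S(t) - T_a^* S(t) T_a] up to
   unimodular factors that cancel. *)
Fixpoint defect (V : Type) (B : V -> V -> C) (F : L -> V -> V) (t : seq L) x y : C :=
  if t is a :: t' then defect B F t' x y - defect B F t' (F a x) (F a y) else B x y.

Lemma q_conj a b : a <> b -> q a b * (q a b)^* = 1.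
Proof. by move=> /qU[h _]; rewrite -normCK h expr1n. Qed.

Lemma In_mask (A : Type) (t : bitseq) (s : seq A) a : List.In a (mask t s) -> List.In a s.
Proof.
by elim: s t => [|b s IH] [|[] t] //=; [case=> [->|/IH]; [left|right]|move=> /IH; right].
Qed.

Section OnH.
Variables (H : lmodType C) (ipH : H -> H -> C) (T : L -> H -> H).
Hypothesis hH : hilbert ipH.
Hypothesis Tc : forall a, contraction ipH (T a).
Hypothesis Tq : q_commuting q T.
Let iH : inner_product ipH := proj1 hH.
Let pH := inner_preip iH.

Lemma contraction_linear a : linear (T a). Proof. exact: (Tc a).1. Qed.
Lemma contraction_le a x : Re (ipH (T a x) (T a x)) <= Re (ipH x x).
Proof. by rewrite -(hnorm_le iH) (Tc a).2. Qed.

Lemma prodT_linear s : linear (prodT T s).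
Proof.
elim: s => [//|a s IH] c x y; rewrite /prodT /= /fcomp -!/(prodT T s).
by rewrite IH contraction_linear.
Qed.
Lemma prodT_le s x : Re (ipH (prodT T s x) (prodT T s x)) <= Re (ipH x x).
Proof.
elim: s => [//|a s IH]; rewrite /prodT /= /fcomp -!/(prodT T s).
exact: le_trans (contraction_le _ _) IH.
Qed.

Lemma iterT_linear a n : linear (iter n (T a)).
Proof. exact/linear_iter/contraction_linear. Qed.
Lemma iterT_le a n x : Re (ipH (iter n (T a) x) (iter n (T a) x)) <= Re (ipH x x).
Proof. by elim: n => [//|n IH] /=; apply: le_trans (contraction_le _ _) IH. Qed.

Lemma hadj_iterT a n x y : ipH (hadj ipH ipH (iter n (T a)) x) y = ipH x (iter n (T a) y).
Proof.
have hh := hadjP hH iH (iterT_linear a n) (iterT_le a n).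
by rewrite (preipJ pH) -hh -(preipJ pH).
Qed.

Lemma prodT_comm a s : ~ List.In a s ->
  exists2 c, c * c^* = 1 & forall x, prodT T s (T a x) = c *: T a (prodT T s x).
Proof.
elim: s => [_|b s IH] /= => [|h]; first by exists 1 => [|x]; rewrite ?rmorph1 ?mulr1 ?scale1r.
have [|c cc hc] := IH; first by move=> as'; apply: h; right.
have ba : b <> a by move=> ba; apply: h; left.
exists (c * q b a) => [|x].
  by rewrite rmorphM mulrACA cc q_conj // mulr1.
rewrite /prodT /= /fcomp -!/(prodT T s) hc (linear_scale _ _ (contraction_linear b)).
by rewrite (Tq ba) scalerA.
Qed.

(** Subsets of [a :: s] are split by whether they contain [a]. For those that do, moving [T a] to
    the innermost place costs a unimodular scalar, which the squared norm does not see, and the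
    extra sign gives the subtraction in [defect]. *)
Lemma S_op_defect s x : List.NoDup s -> ipH (S_op ipH T s x) x = defect ipH T s x x.
Proof.
move=> nd.
have -> : ipH (S_op ipH T s x) x =
    \sum_(b : (size s).-tuple bool) (-1) ^+ size (mask b s) *
      ipH (prodT T (mask b s) x) (prodT T (mask b s) x).
  rewrite /S_op; elim/big_rec2: _ => [|b u v _ <-].
    by have := preipZ pH 0 0 x; rewrite scale0r mul0r.
  rewrite (preipD pH) (preipZ pH); congr (_ * _ + _).
  have h := hadjP hH iH (prodT_linear (mask b s)) (prodT_le (mask b s)).
  by rewrite (preipJ pH) -h -(preipJ pH).
elim: s x nd => [|a s IH] x /= nd.
  rewrite (eq_bigl (pred1 [tuple])); last by case=> -[] // b; apply/esym/eqP/val_inj.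
  by rewrite big_pred1_eq /= mul1r.
have /List.NoDup_cons_iff[as' nd'] := nd; rewrite -!IH //.
rewrite (reindex (fun p : bool * (size s).-tuple bool => [tuple of p.1 :: p.2])) /=; last first.
  exists (fun t : (size s).+1.-tuple bool => (thead t, [tuple of behead t])).
    by move=> [b t] _ /=; congr (_, _); apply: val_inj.
  by move=> t _; rewrite -tuple_eta.
rewrite -(pair_bigA _ (fun b (t : (size s).-tuple bool) => (-1) ^+ size (mask (b :: t) (a :: s)) *
      ipH (prodT T (mask (b :: t) (a :: s)) x) (prodT T (mask (b :: t) (a :: s)) x))) /=.
rewrite big_bool /= addrC; congr (_ + _); rewrite -sumrN; apply: eq_bigr => t _.
rewrite exprS mulN1r mulNr; congr (- (_ * _)).
have [|c cc hc] := @prodT_comm a (mask t s).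
  by move=> h; apply: as'; apply: In_mask h.
by rewrite !hc (preipZ pH) (preipZr pH) mulrA cc mul1r.
Qed.
End OnH.

Section Regularity.
Variables (H : lmodType C) (ipH : H -> H -> C) (T : L -> H -> H).

(** The dilation identity tested against [J x'], with the adjoint powers moved to the other
    argument, whence the [rev]. Neither adjoints nor completeness enter, so it makes sense on the
    pre-Hilbert spaces of the construction. *)
Definition regular_form (V : lmodType C) (B : V -> V -> C) (U Ui : L -> V -> V) (J : H -> V)
    (s : L -> Prop) := forall l, List.NoDup [seq r.1 | r <- l] ->
  (forall b, List.In b [seq r.1 | r <- l] -> s b) -> forall x x',
  B (oact U Ui l (J x)) (J x') = phase q l * ipH (pact T (posl l) x) (pact T (rev (negl l)) x').

(* [N a] plays the role of an invariant space containing the range of [U a J - J (T a)] and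
   orthogonal to [J H]; its existence is what makes a dilation regular. *)
Record defect_space (V : lmodType C) (B : V -> V -> C) (U Ui : L -> V -> V) (J : H -> V)
    (s : L -> Prop) (N : L -> V -> Prop) : Prop := DefectSpace {
  defect_in : forall a x, s a -> N a (U a (J x) - J (T a x));
  defectU : forall a b y, s a -> N a y -> N a (U b y);
  defectUi : forall a b y, s a -> s b -> a <> b -> N a y -> N a (Ui b y);
  defect_orth : forall a y x, s a -> N a y -> B y (J x) = 0 }.

Section Peel.
Variables (V : lmodType C) (B : V -> V -> C) (U Ui : L -> V -> V) (J : H -> V)
    (s : L -> Prop) (N : L -> V -> Prop).
Hypothesis PB : preip +%R *:%R B.
Hypothesis sys : qsys q s U Ui.
Hypothesis Biso : forall a x y, s a -> B (U a x) (U a y) = B x y.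
Hypothesis Jiso : forall x y, B (J x) (J y) = ipH x y.
Hypothesis ds : defect_space B U Ui J s N.

Lemma preipBl_lmod u v w : B (u - v) w = B u w - B v w.
Proof. by have := preipBl PB u v w; rewrite /psub scaleN1r. Qed.

(* The powers in [pact U l (J x)] are replaced one at a time, from the innermost, by powers of [T]:
   each error term lies in some [N a], which [W] preserves. *)
Lemma peel (l : seq (L * nat)) (W : V -> V) x x' : linear W ->
  (forall p, List.In p l -> s p.1) ->
  (forall p, List.In p l -> (0 < p.2)%N -> forall y, N p.1 y -> N p.1 (W y)) ->
  B (W (pact U l (J x))) (J x') = B (W (J (pact T l x))) (J x').
Proof.
elim: l W => //= -[a n] l IH W Wl sl hW /=.
have sa : s a by apply: (sl (a, n)); left.
rewrite (IH (W \o iter n (U a))) /=; first last.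
- move=> p pl p0 y py; apply: hW => //; first by right.
  by elim: (n) => //= k; apply: (defectU ds); apply: sl; right.
- by move=> p pl; apply: sl; right.
- by move=> c u v /=; rewrite (linear_iter n (qsys_linear sys a)) Wl.
have hWa : (0 < n)%N -> forall y, N a y -> N a (W y) by apply: (hW (a, n)); left.
move: (pact T l x) => z {IH hW sl}.
elim: n hWa z => [//|n IHn] hWa z.
rewrite [iter n.+1 (T a) z]iterSr -IHn; last by move=> _; exact: hWa.
rewrite iterSr; apply/eqP; rewrite -subr_eq0 -preipBl_lmod -(linear_sub _ _ Wl).
rewrite -(linear_sub _ _ (linear_iter n (qsys_linear sys a))); apply/eqP.
apply: (defect_orth ds _ sa); apply: hWa => //.
elim: n {IHn} => /= [|n IHn]; first exact: (defect_in ds).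
exact: (defectU ds).
Qed.

Lemma pact_adj (l : seq (L * nat)) y z : (forall p, List.In p l -> s p.1) ->
  B (pact Ui l y) z = B y (pact U (rev l) z).
Proof.
elim: l z => //= -[a n] l IH z sl.
have sa : s a by apply: (sl (a, n)); left.
have -> : pact U (rev ((a, n) :: l)) z = pact U (rev l) (iter n (U a) z).
  by rewrite rev_cons -cats1 /pact foldr_cat.
rewrite -IH; last by move=> p pl; apply: sl; right.
elim: n z {sl} => [//|n IHn] z.
by rewrite iterSr -IHn -(Biso _ _ sa) (qsysVK sys).
Qed.

(** The positive powers are peeled first; the inverse powers then cross to the other argument,
    become positive powers there, and are peeled in turn. *)
Lemma regular_of_defect_space : regular_form B U Ui J s.
Proof.
move=> l nd sl x x'.
rewrite (oact_split qU _ sys) // (preipZ PB); congr (_ * _).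
have sn p : List.In p (negl l) -> s p.1 by move=> /In_negl[r rl ->]; apply: sl; exact: In_fst.
have sp p : List.In p (posl l) -> s p.1 by move=> /In_posl[r rl ->]; apply: sl; exact: In_fst.
rewrite (peel (W := pact Ui (negl l))) //; first last.
- move=> p pl p0 y py; have sa := sp _ pl.
  (* An index with a positive exponent occurs only once, so its inverse is absent from the remaining
     word; inverses with other indices preserve [N p.1] by [defectUi]. *)
  have : forall r, List.In r (negl l) -> r.1 = p.1 -> r.2 = 0%N.
    move=> r /In_negl[r1 r1l ->] /= rp; have [r2 r2l rE] := In_posl pl.
    move: rp p0; rewrite rE /= => r12; have : r1.2 = r2.2.
      by apply: (NoDup_fst_inj nd (a := r1.1)); [case: (r1) r1l|rewrite r12; case: (r2) r2l].
    by move=> ->; case: (r2.2).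
  elim: (negl l) sn => //= -[b n] m IH sm hm.
  have h : N p.1 (pact Ui m y).
    by apply: IH => [r rm|r rm]; [apply: sm; right|apply: hm; right].
  case: n hm sm => [//|n] hm sm.
  have bp : p.1 <> b by move=> pb; have := hm (b, n.+1) (or_introl erefl) (esym pb).
  have sb : s b by apply: (sm (b, n.+1)); left.
  by elim: n.+1 => //= k; apply: (defectUi ds).
- by apply: pact_linear => p /sn sp1; apply: (qsys_linearV sys).
rewrite pact_adj // (preipJ PB).
have sr p : List.In p (rev (negl l)) -> s p.1.
  elim: (negl l) sn => //= r m IH sm; rewrite rev_cons -cats1 => /List.in_app_iff[h|[<-|//]].
    by apply: IH => // r' r'm; apply: sm; right.
  by apply: sm; left.
by rewrite (peel (W := idfun)) // -(preipJ PB) Jiso.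
Qed.
End Peel.
End Regularity.
End Defect.

(** * Necessity *)

Section Clause.
Variables (R : realType) (L : Type) (q : L -> L -> R[i]).
Local Notation C := R[i].

Lemma big_fcompE (V : Type) k (F : 'I_k -> V -> V) x :
  (\big[@fcomp V/idfun]_(i < k) F i) x = foldr F x (enum 'I_k).
Proof.
elim: k F => [|k IH] F; first by rewrite big_ord0 enum_ord0.
by rewrite big_ord_recl enum_ordSl /= foldr_map /fcomp IH.
Qed.

Lemma phase_ord k (a : 'I_k -> L) (m : 'I_k -> int) :
  phase q [seq (a i, m i) | i <- enum 'I_k] =
  \prod_(i < k) \prod_(j < k | (i < j)%N)
     q (a i) (a j) ^ (- ((mplus (m i) * mminus (m j))%N : int)).
Proof.
elim: k a m => [|k IH] a m; first by rewrite enum_ord0 big_ord0.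
rewrite enum_ordSl /= -map_comp big_ord_recl; congr (_ * _).
  rewrite big_map big_enum /= [RHS]big_mkcond big_ord_recl /= mul1r.
  by apply: eq_big => i.
rewrite [LHS](IH (a \o lift ord0) (m \o lift ord0)); apply: eq_bigr => i _.
rewrite [RHS]big_mkcond big_ord_recl /= mul1r [LHS]big_mkcond.
by apply: eq_bigr => j _ /=; rewrite /bump !add1n ltnS.
Qed.

Lemma In_mapP (A : eqType) (f : A -> L) s b :
  List.In b (map f s) <-> exists2 i, i \in s & f i = b.
Proof.
elim: s => [|i s IH] /=; first by split=> // -[].
split=> [[<-|/IH[j js <-]]|[j]]; first by exists i; rewrite ?mem_head.
  by exists j => //; rewrite inE js orbT.
by rewrite inE => /orP[/eqP->|js] fj; [left|right; apply/IH; exists j].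
Qed.

Lemma NoDup_map_uniq (A : eqType) (f : A -> L) s : uniq s ->
  List.NoDup (map f s) <-> {in s &, injective f}.
Proof.
elim: s => [|i s IH] /=; first by split=> // _; constructor.
move=> /andP[i_s us]; rewrite List.NoDup_cons_iff In_mapP IH //; split.
  move=> [nf inj] j k; rewrite !inE => /orP[/eqP->|js] /orP[/eqP->|ks] //; last exact: inj.
  - by move=> h; case: nf; exists k.
  - by move=> h; case: nf; exists j.
move=> inj; split; last by move=> j k js ks; apply: inj; rewrite inE ?js ?ks orbT.
move=> [j js fj]; move: i_s; rewrite -(inj j i) ?js //; last exact: mem_head.
by rewrite inE js orbT.
Qed.

Section Dilation.
Variables (H : lmodType C) (ipH : H -> H -> C) (T : L -> H -> H).
Hypothesis hH : hilbert ipH.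
Hypothesis Tc : forall a, contraction ipH (T a).
Let iH : inner_product ipH := proj1 hH.
Let pH := inner_preip iH.
Variables (K : lmodType C) (ipK : K -> K -> C) (J : H -> K) (U : L -> K -> K).
Hypothesis iK : inner_product ipK.
Hypothesis Jisom : isometric_embedding ipH ipK J.
Local Notation Ui := (fun a => hadj ipK ipK (U a)).

Lemma hadj_isom x y : ipH (hadj ipH ipK J y) x = ipK y (J x).
Proof.
have h := hadjP hH iK Jisom.1.
by rewrite (preipJ pH) -h ?(preipJ (inner_preip iK) (J x)) // => z; rewrite Jisom.2.
Qed.

Lemma hadj_iter_prod (l : seq (L * int)) y z :
  ipH (foldr (fun p => hadj ipH ipH (iter (mminus p.2) (T p.1))) y l) z =
  ipH y (pact T (rev (negl l)) z).
Proof.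
elim: l z => //= p l IH z.
by rewrite hadj_iterT // IH rev_cons -cats1 /pact foldr_cat.
Qed.

(** Injective families indexed by ['I_k] correspond to duplicate-free lists, and an identity between
    vectors of [H] is equivalent to its inner products with all [x']. *)
Lemma regular_clause :
  (forall (k : nat) (a : 'I_k -> L) (m : 'I_k -> int), injective a -> forall x : H,
     hadj ipH ipK J ((\big[@fcomp K/idfun]_(i < k) upow ipK (U (a i)) (m i)) (J x))
     = (\prod_(i < k) \prod_(j < k | (i < j)%N)
          q (a i) (a j) ^ (- ((mplus (m i) * mminus (m j))%N : int)))
       *: (\big[@fcomp H/idfun]_(i < k) hadj ipH ipH (iter (mminus (m i)) (T (a i))))
            ((\big[@fcomp H/idfun]_(i < k) iter (mplus (m i)) (T (a i))) x)) <->
  regular_form q ipH T ipK U Ui J (fun=> True).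
Proof.
have conv k (a : 'I_k -> L) (m : 'I_k -> int) x x' (l := [seq (a i, m i) | i <- enum 'I_k]) :
    ipH (hadj ipH ipK J ((\big[@fcomp K/idfun]_(i < k) upow ipK (U (a i)) (m i)) (J x))) x' =
      ipK (oact U Ui l (J x)) (J x') /\
    ipH ((\prod_(i < k) \prod_(j < k | (i < j)%N)
          q (a i) (a j) ^ (- ((mplus (m i) * mminus (m j))%N : int)))
       *: (\big[@fcomp H/idfun]_(i < k) hadj ipH ipH (iter (mminus (m i)) (T (a i))))
            ((\big[@fcomp H/idfun]_(i < k) iter (mplus (m i)) (T (a i))) x)) x' =
      phase q l * ipH (pact T (posl l) x) (pact T (rev (negl l)) x').
  rewrite hadj_isom !big_fcompE /oact /l foldr_map /=; split => //.
  rewrite (preipZ pH) phase_ord; congr (_ * _).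
  rewrite -hadj_iter_prod foldr_map /=; congr (ipH (foldr _ _ _) _).
  by rewrite /pact /posl -map_comp foldr_map.
split=> [h l nd _ x x'|h k a m inj x].
  pose t := in_tuple l; pose a i := (tnth t i).1; pose m i := (tnth t i).2.
  have lE : l = [seq (a i, m i) | i <- enum 'I_(size l)].
    rewrite -[LHS]/(tval t) -[LHS]map_tnth_enum; apply: eq_map => i.
    by rewrite /a /m; case: (tnth t i).
  have [e1 e2] := conv _ a m x x'.
  rewrite lE -e1 -e2 h // => i j; apply: (iffLR (NoDup_map_uniq a (enum_uniq 'I_(size l)))); rewrite ?mem_enum //.
  by have := nd; rewrite {1}lE -map_comp.
apply: (inner_ext iH) => z; rewrite (preipJ pH _ z) [RHS](preipJ pH _ z); congr (_^*).
have [-> ->] := conv k a m x z; apply: h => //.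
by rewrite -map_comp; apply/(NoDup_map_uniq _ (enum_uniq 'I_k)) => i j _ _ /inj.
Qed.
End Dilation.
End Clause.

Section Necessity.
Variables (R : realType) (L : Type) (q : L -> L -> R[i]).
Local Notation C := R[i].
Hypothesis qU : unimodular_q q.
Variables (H : lmodType C) (ipH : H -> H -> C) (T : L -> H -> H).
Hypothesis Tq : q_commuting q T.
Variables (K : lmodType C) (ip : K -> K -> C) (J : H -> K) (U Ui : L -> K -> K).
Hypothesis pK : preip +%R *:%R ip.
Hypothesis Jl : linear J.
Hypothesis Jiso : forall x y, ip (J x) (J y) = ipH x y.
Hypothesis sys : qsys q (fun=> True) U Ui.
Hypothesis Uadj : forall a x y, ip (U a x) y = ip x (Ui a y).
Hypothesis reg : regular_form q ipH T ip U Ui J (fun=> True).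

Lemma phase_rcons l a : phase q (l ++ [:: (a, 1)]) = phase q l.
Proof.
elim: l => [|[b m] l IH] /=; first by rewrite big_nil mulr1.
by rewrite IH big_cat big_cons big_nil /= muln0 oppr0 expr0z !mulr1.
Qed.

Lemma NoDup_rcons (l : seq L) a : List.NoDup l -> ~ List.In a l -> List.NoDup (l ++ [:: a]).
Proof.
elim: l => [_ _|b l IH /List.NoDup_cons_iff[bl nd] al] /=; first by constructor => //; constructor.
apply/List.NoDup_cons_iff; split; last by apply: IH => // h; apply: al; right.
by move=> /List.in_app_iff[//|[ab|//]]; apply: al; left.
Qed.

(* The largest candidate for the space [N a] of a given regular dilation. *)
Definition word_orth a y := forall w, ~ List.In a [seq r.1 | r <- w] ->
  forall x, ip (act U Ui w y) (J x) = 0.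

Lemma act_linear w : linear (act U Ui w).
Proof.
elim: w => [//|p w IH] c x y /=.
by rewrite IH (letter_linear sys).
Qed.

(** Because [w] avoids [a], its normal form can be followed by [(a, 1)]. Such a last factor adds
    neither a phase nor an adjoint, so regularity gives [U a (J x)] and [J (T a x)] the same
    value. *)
Lemma word_orth_gen a x : word_orth a (U a (J x) - J (T a x)).
Proof.
move=> w aw x'; rewrite (linear_sub _ _ (act_linear w)) (preipBl_lmod pK).
have [c [l [nd [lw h]]]] := word_normal qU w.
rewrite !(h _ _ _ _ sys) // !(preipZ pK) -mulrBr.
suff -> : ip (oact U Ui l (U a (J x))) (J x') = ip (oact U Ui l (J (T a x))) (J x').
  by rewrite subrr mulr0.
rewrite reg //; have := @reg (l ++ [:: (a, 1)]) _ _ x x'.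
rewrite /oact foldr_cat /= => ->; rewrite ?map_cat //; last by apply: NoDup_rcons => // /lw.
rewrite phase_rcons /posl /negl !map_cat rev_cat /=; congr (_ * ipH _ _).
by rewrite /pact foldr_cat.
Qed.

Lemma word_orth_letter a p y : a <> p.1 -> word_orth a y -> word_orth a (letter U Ui p y).
Proof.
move=> ap h w aw x; have -> : act U Ui w (letter U Ui p y) = act U Ui (w ++ [:: p]) y.
  by rewrite /act foldr_cat.
apply: h; rewrite map_cat => /List.in_app_iff[//|[pa|//]]; exact: ap.
Qed.

Lemma word_orthB a c y z : word_orth a y -> word_orth a z -> word_orth a (y - c *: z).
Proof.
move=> hy hz w aw x; rewrite (linear_sub _ _ (act_linear w)) (linear_scale _ _ (act_linear w)).
by rewrite (preipBl_lmod pK) (preipZ pK) hy // hz // mulr0 subr0.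
Qed.

(* Up to phases, the sum over [v] included in [s] of [(-1)^|v| U_v^* J T_v x]. *)
Fixpoint defect_vec s x := if s is a :: s' then defect_vec s' x - Ui a (defect_vec s' (T a x)) else J x.

Hypothesis Tl : forall a, linear (T a).

Lemma defect_vec_linear s : linear (defect_vec s).
Proof.
elim: s => [//|a s IH] c x y /=.
by rewrite Tl !IH (qsys_linearV sys) // scalerBr opprD addrACA.
Qed.

Lemma word_orth_defect_vec s a x : ~ List.In a s ->
  word_orth a (U a (defect_vec s x) - defect_vec s (T a x)).
Proof.
elim: s x => [|b s IH] x /= as'; first exact: word_orth_gen.
have ab : a <> b by move=> ab; apply: as'; left.
have as1 : ~ List.In a s by move=> h; apply: as'; right.
(* The factor [(q a b)^-1] arises when [U a] passes [Ui b]; on the other term it cancels the [q a b]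
   of [T a (T b x) = q a b *: T b (T a x)]. *)
have := word_orthB (q a b)^-1 (IH x as1) (@word_orth_letter a (b, false) _ ab (IH (T b x) as1)).
congr word_orth; rewrite /letter /= (linear_sub _ _ (qsys_linear sys a)) (qsys_UUi qU sys ab) //.
rewrite (linear_sub _ _ (qsys_linearV sys I)) (Tq ab).
rewrite (linear_scale _ _ (defect_vec_linear s)) (linear_scale _ _ (qsys_linearV sys I)).
rewrite scalerBr scalerA mulVf ?q_neq0 // scale1r !opprB.
rewrite addrACA [RHS]addrACA; congr (_ + _).
by rewrite addrC.
Qed.

Lemma defect_vec_orth s a y x : ~ List.In a s -> word_orth a y -> ip y (defect_vec s x) = 0.
Proof.
elim: s y x => [|b s IH] y x /= as' hy; first by apply: (hy [::]).
have ab : a <> b by move=> ab; apply: as'; left.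
have as1 : ~ List.In a s by move=> h; apply: as'; right.
have := preipBr pK (defect_vec s x) (Ui b (defect_vec s (T b x))) y; rewrite /psub scaleN1r => ->.
rewrite IH // -Uadj IH ?subr0 //.
exact: (@word_orth_letter a (b, true)).
Qed.

Lemma defect_vec_norm s x : List.NoDup s ->
  ip (defect_vec s x) (defect_vec s x) = defect ipH T s x x.
Proof.
elim: s x => [|a s IH] x /=; first by rewrite Jiso.
move=> /List.NoDup_cons_iff[as' nd]; rewrite -!IH //.
set e := defect_vec s x; set f := defect_vec s (T a x).
have ef : ip (U a e) f = ip f f.
  apply/eqP; rewrite -subr_eq0 -(preipBl_lmod pK); apply/eqP.
  by apply: (defect_vec_orth _ as'); exact: word_orth_defect_vec.
have Br u v w : ip w (u - v) = ip w u - ip w v.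
  by have := preipBr pK u v w; rewrite /psub scaleN1r.
rewrite (preipBl_lmod pK) !Br -!Uadj (qsysVK sys) // ef (preipJ pK e (Ui a f)) -Uadj ef -(preipJ pK).
by rewrite subrr subr0.
Qed.

End Necessity.

(** * Dilating one operator of the family *)

Section PartialDilation.
Variables (R : realType) (L : Type) (q : L -> L -> R[i]).
Local Notation C := R[i].
Hypothesis qU : unimodular_q q.
Variables (H : lmodType C) (ipH : H -> H -> C) (T : L -> H -> H).

(* The operators indexed by [s] have been made unitary, those outside [s] still extend the [T b]. *)
Record partial_dilation (s : seq L) (V : lmodType C) (B : V -> V -> C) (U Ui : L -> V -> V)
    (J : H -> V) (N : L -> V -> Prop) : Prop := PartialDilation {
  pd_preip : preip +%R *:%R B;
  pd_sys : qsys q (fun a => List.In a s) U Ui;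
  pd_iso : forall a x y, List.In a s -> B (U a x) (U a y) = B x y;
  pd_defect : forall t, List.NoDup t -> (forall b, List.In b t -> ~ List.In b s) ->
    forall x, 0 <= defect B U t x x;
  pd_linear : linear J;
  pd_isom : forall x y, B (J x) (J y) = ipH x y;
  pd_intertwine : forall b x, ~ List.In b s -> J (T b x) = U b (J x);
  pd_space : defect_space T B U Ui J (fun a => List.In a s) N;
  pd_spaceZ : forall a c y, List.In a s -> N a y -> N a (c *: y) }.

Section Step.
Variables (s : seq L) (V : lmodType C) (B : V -> V -> C) (U Ui : L -> V -> V)
  (J : H -> V) (N : L -> V -> Prop).
Hypothesis pd : partial_dilation s B U Ui J N.
Variable a : L.
Hypothesis as' : ~ List.In a s.
Let PB := pd_preip pd.
Let sys := pd_sys pd.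
Let Ul := qsys_linear sys.
Let U0 b : U b 0 = 0. Proof. by have := linear_scale 0 0 (Ul b); rewrite !scale0r. Qed.

(* A vector [y] of the dilation space of [U a] is encoded by the sequence of its compressions
   [P U_a^p y]; for the span of the [U_a^p V] these sequences vanish near -oo and satisfy
   [y (p + 1) = U a (y p)] near +oo. The dilated [U a] is the shift, and [U b] acts by
   [q a b ^ p *: U b] on the [p]-th entry. *)
Definition valid (n : nat) (y : int -> V) :=
  (forall p : int, p < - n%:Z -> y p = 0) /\ (forall p : int, n%:Z <= p -> y (p + 1) = U a (y p)).

Lemma valid_le n m y : (n <= m)%N -> valid n y -> valid m y.
Proof. by move=> nm [h1 h2]; split=> p hp; [apply: h1|apply: h2]; lia. Qed.

Lemma valid0 : exists n, valid n (0 : int -> V).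
Proof. by exists 0%N; split=> // p _; rewrite U0. Qed.

Lemma validZD c n (y z : int -> V) : valid n y -> valid n z -> valid n (c *: y + z).
Proof.
move=> [y1 y2] [z1 z2]; have E p : (c *: y + z) p = c *: y p + z p by [].
by split=> p hp; rewrite !E; [rewrite y1 // z1 // scaler0 addr0|rewrite y2 // z2 // Ul].
Qed.

Lemma validZD_ex c (y z : int -> V) : (exists n, valid n y) -> (exists n, valid n z) ->
  exists n, valid n (c *: y + z).
Proof.
move=> [n yn] [m zm]; exists (maxn n m).
by apply: validZD; [apply: valid_le yn; apply: leq_maxl|apply: valid_le zm; apply: leq_maxr].
Qed.

Definition trace_sub := @Submodule R (int -> V : lmodType C) (fun y => exists n, valid n y) valid0 validZD_ex.
Definition trace := smod trace_sub.

Lemma smod_valZDp c (y z : trace) p : smod_val (c *: y + z) p = c *: smod_val y p + smod_val z p.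
Proof. by []. Qed.

Lemma smod_valZp c (y : trace) p : smod_val (c *: y) p = c *: smod_val y p.
Proof. by []. Qed.

(* [|y|^2] is the telescoping sum of [|y p|^2 - |U a (y p)|^2] plus the final term [|y n|^2];
   it stabilises for large [n]. *)
Definition window (F : V -> V -> C) n (y z : int -> V) : C :=
  \sum_(0 <= i < n + n) (F (y (i%:Z - n%:Z)) (z (i%:Z - n%:Z)) -
     F (U a (y (i%:Z - n%:Z))) (U a (z (i%:Z - n%:Z)))) + F (y n) (z n).

(** On the left the new term is zero because the traces vanish there; on the right the new summand
    telescopes with the final term, since [y (n + 1) = U a (y n)]. *)
Lemma windowS F n (y z : int -> V) : valid n y -> valid n z -> window F n.+1 y z = window F n y z.
Proof.
move=> [y1 y2] [z1 z2]; rewrite /window addSn addnS big_nat_recl // big_nat_recr //=.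
rewrite y1; last by lia.
rewrite z1; last by lia.
rewrite !U0 subrr add0r -addrA; congr (_ + _).
  by apply: eq_bigr => i _; rewrite (_ : i.+1%:Z - n.+1%:Z = i%:Z - n%:Z) //; lia.
rewrite (_ : (n + n).+1%:Z - n.+1%:Z = n%:Z); last by lia.
by rewrite -addn1 PoszD y2 // z2 // subrK.
Qed.

Lemma window_stable F n m (y z : int -> V) : (n <= m)%N -> valid n y -> valid n z ->
  window F m y z = window F n y z.
Proof.
move=> nm yn zn; have -> : m = (m - n + n)%N by rewrite subnK.
elim: (m - n)%N => [//|k IH]; rewrite addSn -[RHS]IH.
by apply: windowS; [apply: valid_le yn|apply: valid_le zn]; exact: leq_addl.
Qed.

Definition tform (y z : trace) : C :=
  xget 0 [set c | exists n, valid n (smod_val y) /\ valid n (smod_val z) /\ c = window B n (smod_val y) (smod_val z)]%classic.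

Lemma tformE n (y z : trace) : valid n (smod_val y) -> valid n (smod_val z) -> tform y z = window B n (smod_val y) (smod_val z).
Proof.
move=> yn zn; rewrite /tform; case: xgetP => [c _ [m [ym [zm ->]]]|/(_ (window B n (smod_val y) (smod_val z)))[]].
  have [nm|mn] := leqP n m; first exact: window_stable.
  by symmetry; apply: window_stable => //; exact: ltnW.
by exists n.
Qed.

Lemma valid_common (y z : trace) : exists n, valid n (smod_val y) /\ valid n (smod_val z).
Proof.
have [n yn] := smodP y; have [m zm] := smodP z; exists (maxn n m).
by split; [apply: valid_le yn; apply: leq_maxl|apply: valid_le zm; apply: leq_maxr].
Qed.

Lemma tform_preip : preip +%R *:%R tform.
Proof.
have BD := preipD PB; have BZ := preipZ PB.
have key c u v w : tform (c *: u + v) w = c * tform u w + tform v w.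
  have [n [un vn]] := valid_common u v; have [m [um wm]] := valid_common u w.
  have leN := leq_maxl n m; have leM := leq_maxr n m; set k := maxn n m in leN leM.
  have {un um} uk := valid_le leN un; have {vn} vk := valid_le leN vn; have {wm} wk := valid_le leM wm.
  rewrite (tformE uk wk) (tformE vk wk) (tformE (n := k)) //; last exact: validZD.
  have E p : (c *: smod_val u + smod_val v) p = c *: smod_val u p + smod_val v p by [].
  rewrite /window mulrDr addrACA; congr (_ + _); last by rewrite smod_valZDp BD BZ.
  rewrite mulr_sumr -big_split /=; apply: eq_bigr => i _.
  rewrite !E.
  by rewrite Ul !(BD, BZ); ring.
split.
- by move=> u v w; rewrite -[u]scale1r key mul1r scale1r.
- move=> c u w; have h0 : tform 0 w = 0.
    have := key 1 0 0 w; rewrite scaler0 addr0 mul1r => h.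
    by apply: (@addrI _ (tform 0 w)); rewrite addr0 -h.
  by rewrite -[c *: u]addr0 key h0 addr0.
- move=> u v; have [n [un vn]] := valid_common u v.
  rewrite (tformE un vn) (tformE vn un) /window rmorphD rmorph_sum /= (preipJ PB); congr (_ + _).
  by apply: eq_bigr => i _; rewrite rmorphB /= -!(preipJ PB).
move=> u; have [n [un _]] := valid_common u u; rewrite (tformE un un) /window.
apply: addr_ge0; last exact: (preip_ge0 PB).
apply: sumr_ge0 => i _; apply: (pd_defect pd (t := [:: a])).
  by constructor => //; constructor.
by move=> b [<-|].
Qed.

Definition shift (k : int) (y : int -> V) : int -> V := fun p => y (p + k).
Definition twist (c : C) (f : V -> V) (y : int -> V) : int -> V := fun p => c ^ p *: f (y p).

Lemma valid_shift k n y : valid n y -> valid (n + `|k|)%N (shift k y).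
Proof.
move=> [y1 y2]; split=> p hp; rewrite /shift; first by apply: y1; lia.
by rewrite addrAC y2 //; lia.
Qed.

(** The power [c ^ p] is forced by the recursion [y (p + 1) = U a (y p)]: each further [U a] that
    passes [f] contributes one more factor [c]. *)
Lemma valid_twist c f n y : c != 0 -> linear f -> qcomm c (U a) f -> valid n y -> valid n (twist c f y).
Proof.
move=> c0 fl fc [y1 y2]; split=> p hp; rewrite /twist.
  by rewrite y1 // -(scale0r (0 : V)) (linear_scale _ _ fl) !scale0r scaler0.
by rewrite y2 // (linear_scale _ _ (Ul a)) fc scalerA expfzDr // expr1z.
Qed.

Definition tU b : trace -> trace := fun y => smod_of trace_sub
  (if `[< b = a >] then shift 1 (smod_val y) else twist (q a b) (U b) (smod_val y)).
(** For [b] outside [a :: s] the twisted sequence need not be valid, and [smod_of] then returns the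
    default [0]; [qsys] constrains the inverses only on [a :: s]. *)
Definition tUi b : trace -> trace := fun y => smod_of trace_sub
  (if `[< b = a >] then shift (-1) (smod_val y) else twist (q a b)^-1 (Ui b) (smod_val y)).

Lemma tU_self (y : trace) p : smod_val (tU a y) p = smod_val y (p + 1).
Proof.
rewrite /tU smod_ofK asboolT //; have [n yn] := smodP y.
by exists (n + 1)%N; exact: (valid_shift 1 yn).
Qed.
Lemma tUi_self (y : trace) p : smod_val (tUi a y) p = smod_val y (p - 1).
Proof.
rewrite /tUi smod_ofK asboolT //; have [n yn] := smodP y.
by exists (n + 1)%N; exact: (valid_shift (-1) yn).
Qed.
Lemma valid_tU b n (y : trace) : a <> b -> valid n (smod_val y) -> valid n (twist (q a b) (U b) (smod_val y)).
Proof.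
by move=> ab; apply: valid_twist; [exact: q_neq0| |exact: (qsys_comm sys)].
Qed.
Lemma tU_other b (y : trace) p : a <> b -> smod_val (tU b y) p = (q a b) ^ p *: U b (smod_val y p).
Proof.
move=> ab; rewrite /tU asboolF; last by move=> ba; apply: ab.
by rewrite smod_ofK //; have [n yn] := smodP y; exists n; exact: valid_tU.
Qed.
Lemma tUi_other b (y : trace) p : a <> b -> List.In b s ->
  smod_val (tUi b y) p = (q a b)^-1 ^ p *: Ui b (smod_val y p).
Proof.
move=> ab bs; rewrite /tUi asboolF; last by move=> ba; apply: ab.
rewrite smod_ofK //; have [n yn] := smodP y; exists n; apply: valid_twist yn.
- by rewrite invr_eq0 q_neq0.
- exact: (qsys_linearV sys).
- exact: (qsys_UUi qU sys).
Qed.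

Lemma trace_ext (y z : trace) : (forall p, smod_val y p = smod_val z p) -> y = z.
Proof. by move=> h; apply: smod_inj; apply/funext. Qed.

Lemma tU_linear b : linear (tU b).
Proof.
move=> c y z; apply: trace_ext => p; rewrite smod_valZDp.
have [ba|ba] := pselect (a = b); first by rewrite -ba !tU_self.
by rewrite !tU_other // smod_valZDp Ul scalerDr !scalerA mulrC.
Qed.

Lemma trace_sys : qsys q (fun b => List.In b (a :: s)) tU tUi.
Proof.
split.
- exact: tU_linear.
- move=> b bs y; apply: trace_ext => p.
  have [ba|ba] := pselect (a = b); first by rewrite -ba tUi_self tU_self subrK.
  have bs' : List.In b s by case: bs.
  rewrite tUi_other // tU_other // (linear_scale _ _ (qsys_linearV sys bs')) (qsysK sys) // scalerA.
  by rewrite exprz_inv -expfzDr ?q_neq0 // addNr expr0z scale1r.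
- move=> b bs y; apply: trace_ext => p.
  have [ba|ba] := pselect (a = b); first by rewrite -ba tU_self tUi_self addrK.
  have bs' : List.In b s by case: bs.
  rewrite tU_other // tUi_other // (linear_scale _ _ (Ul b)) (qsysVK sys) // scalerA.
  by rewrite exprz_inv -expfzDr ?q_neq0 // subrr expr0z scale1r.
move=> b c bc y; apply: trace_ext => p; rewrite smod_valZp.
have [ab|ab] := pselect (a = b).
  have ac : a <> c by rewrite ab.
  by rewrite -ab tU_self !(tU_other _ _ ac) tU_self scalerA expfzDr ?q_neq0 // expr1z mulrC.
have [ac|ac] := pselect (a = c).
  rewrite -ac !(tU_other _ _ ab) !tU_self (tU_other _ _ ab) scalerA.
  have ba : b <> a by move=> ba; apply: ab.
  by have [_ ->] := qU ba; rewrite expfzDr ?q_neq0 // expr1z mulrC mulfK ?q_neq0.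
rewrite !tU_other // !(linear_scale _ _ (Ul _)) (qsys_comm sys bc) !scalerA.
by congr (_ *: _); ring.
Qed.

Lemma defectZ t c u v : defect B U t (c *: u) (c *: v) = c * c^* * defect B U t u v.
Proof.
elim: t u v => [|b t IH] u v /=; first by rewrite (preipZ PB) (preipZr PB) mulrA.
by rewrite !(linear_scale _ _ (Ul _)) !IH mulrBr.
Qed.

Lemma expz_conj (c : C) (p : int) : c * c^* = 1 -> c ^ p * (c ^ p)^* = 1.
Proof.
move=> cc; case: p => n; first by rewrite -exprnP rmorphXn -exprMn cc expr1n.
by rewrite NegzE -exprnN fmorphV rmorphXn -invfM -exprMn cc expr1n invr1.
Qed.

Lemma tU_valid b n (y : trace) : a <> b -> valid n (smod_val y) -> valid n (smod_val (tU b y)).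
Proof.
move=> ab yn; rewrite (_ : smod_val (tU b y) = twist (q a b) (U b) (smod_val y)); first exact: valid_tU.
by apply/funext => p; rewrite tU_other.
Qed.

(** For [b <> a], [tU b] acts entrywise up to unimodular scalars, which a sesquilinear form does not
    see; taking defects therefore commutes with forming the window. *)
Lemma defect_tform t n (y z : trace) : ~ List.In a t ->
  valid n (smod_val y) -> valid n (smod_val z) ->
  defect tform tU t y z = window (defect B U t) n (smod_val y) (smod_val z).
Proof.
elim: t y z => [|b t IH] y z at' yn zn; first exact: tformE.
have ab : a <> b by move=> ab; apply: at'; left.
have at1 : ~ List.In a t by move=> h; apply: at'; right.
rewrite /= !IH //; try exact: tU_valid.
have qc p := expz_conj p (q_conj qU ab).
have E (u v : V) p : defect B U t (q a b ^ p *: U b u) (q a b ^ p *: U b v) = defect B U t (U b u) (U b v).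
  by rewrite defectZ qc mul1r.
have E' (u v : V) p : defect B U t (U a (q a b ^ p *: U b u)) (U a (q a b ^ p *: U b v)) =
    defect B U t (U b (U a u)) (U b (U a v)).
  rewrite !(linear_scale _ _ (Ul a)) defectZ qc mul1r !(qsys_comm sys ab) defectZ q_conj // mul1r.
  by [].
rewrite /window opprD addrACA -sumrB; congr (_ + _); last by rewrite !tU_other // E.
by apply: eq_bigr => i _; rewrite !tU_other // E E' /=; ring.
Qed.

Lemma tform_iso b y z : List.In b (a :: s) -> tform (tU b y) (tU b z) = tform y z.
Proof.
move=> bs; have [n [yn zn]] := valid_common y z.
have [ab|ab] := pselect (a = b); last first.
  have bs' : List.In b s by case: bs.
  (* The difference of the two sides is the defect form of [[:: b]], whose window consists of zeros
     because [U b] is already isometric on [V]. *)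
  apply/esym/eqP; rewrite -subr_eq0; apply/eqP.
  have at1 : ~ List.In a [:: b] by case=> // /esym.
  rewrite -[LHS]/(defect tform tU [:: b] y z) (defect_tform at1 yn zn) /window /=.
  rewrite !(pd_iso pd _ _ bs') !subrr big1 ?addr0 // => i _.
  by rewrite !(pd_iso pd _ _ bs') !subrr.
rewrite -ab.
have E (x : trace) : smod_val (tU a x) = shift 1 (smod_val x).
  by apply/funext => p; rewrite tU_self.
(* A shift by one may move the left end of the support by one, hence the window [n.+1]. After
   reindexing, the two windows differ by a zero term on the left and a telescoping one on the
   right. *)
have sv x : valid n (smod_val x) -> valid n.+1 (smod_val (tU a x)).
  by rewrite E -addn1; exact: (@valid_shift 1).
rewrite (tformE (sv _ yn) (sv _ zn)) (tformE (n := n.+1)); first last.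
- exact: valid_le zn.
- exact: valid_le yn.
rewrite /window !E /shift addSn addnS.
have [y1 y2] := yn; have [z1 z2] := zn.
rewrite [in RHS]big_nat_recl // [in LHS]big_nat_recr //=.
rewrite [smod_val y (0%:Z - _)]y1; last by lia.
rewrite [smod_val z (0%:Z - _)]z1; last by lia.
rewrite !U0 subrr add0r -addrA; congr (_ + _).
  apply: eq_bigr => i _.
  by rewrite (_ : i%:Z - n.+1%:Z + 1 = i.+1%:Z - n.+1%:Z) //; lia.
rewrite (_ : (n + n).+1%:Z - n.+1%:Z + 1 = n.+1%:Z); last by lia.
rewrite y2; last by lia.
rewrite z2; last by lia.
by rewrite subrK.
Qed.

Lemma tform_defect_ge0 t (y : trace) : List.NoDup t -> (forall b, List.In b t -> ~ List.In b (a :: s)) ->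
  0 <= defect tform tU t y y.
Proof.
move=> nd ts; have [n [yn _]] := valid_common y y.
have at' : ~ List.In a t by move=> /ts; apply; left.
have ts' b : List.In b t -> ~ List.In b s by move=> /ts h bs; apply: h; right.
rewrite (defect_tform at' yn yn) /window; apply: addr_ge0; last exact: (pd_defect pd).
apply: sumr_ge0 => i _; apply: (pd_defect pd (t := a :: t)); first exact/List.NoDup_cons_iff.
by move=> b [<-|/ts'].
Qed.

(** The entries at negative positions are [0], so that [tU a (tJ x) - tJ (T a x)] is concentrated at
    position [-1]. *)
Definition tJ (x : H) : trace := smod_of trace_sub
  (fun p => if p is Posz n then iter n (U a) (J x) else 0).

Lemma tJ_fun_valid x : valid 0 (fun p => if p is Posz n then iter n (U a) (J x) else 0).
Proof.
split=> [[n|n]|[n|n]] hp; try lia; first by [].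
by rewrite -PoszD addn1.
Qed.
Lemma tJE x p : smod_val (tJ x) p = if p is Posz n then iter n (U a) (J x) else 0.
Proof. by rewrite smod_ofK //; exists 0%N; exact: tJ_fun_valid. Qed.
Lemma tJ_valid x : valid 0 (smod_val (tJ x)).
Proof.
rewrite (_ : smod_val (tJ x) = (fun p => if p is Posz n then iter n (U a) (J x) else 0)).
  exact: tJ_fun_valid.
by apply/funext => p; rewrite tJE.
Qed.
Lemma tJE_JT x n : smod_val (tJ x) (Posz n) = J (iter n (T a) x).
Proof. by rewrite tJE; elim: n => //= n ->; rewrite (pd_intertwine pd). Qed.

(** For the new index these are the traces supported at negative positions, hence orthogonal to the
    range of [tJ], and the shift [tU a] only moves them further left. For old indices membership is
    tested entry by entry. *)
Definition tN c (y : trace) : Prop :=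
  if `[< c = a >] then forall n : nat, smod_val y (Posz n) = 0 else forall p, N c (smod_val y p).

Lemma N0 c : List.In c s -> N c 0.
Proof.
move=> cs; have := pd_spaceZ pd 0 cs (defect_in (pd_space pd) 0 cs).
by rewrite scale0r.
Qed.

Lemma trace_defect_space :
  defect_space T tform tU tUi tJ (fun c => List.In c (a :: s)) tN.
Proof.
have ds := pd_space pd.
have Nit c n y : List.In c s -> N c y -> N c (iter n (U a) y).
  by move=> cs h; elim: n => //= n IH; apply: (defectU ds).
split.
- move=> c x cs; have subE (u v : trace) p : smod_val (u - v) p = smod_val u p - smod_val v p by [].
  rewrite /tN; case: asboolP => [ca n|ca].
    rewrite ca subE tU_self -PoszD addn1 !tJE (pd_intertwine pd) //.
    by rewrite -iterSr subrr.
  have ac : a <> c by move=> ac; apply: ca.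
  have {}cs : List.In c s by case: cs.
  case=> n; rewrite subE tU_other // !tJE; last first.
    by rewrite subr0 (_ : U c 0 = 0) ?scaler0; [exact: N0|exact: U0].
  rewrite -exprnP -(qcomm_iterl n (Ul a) (qsys_comm sys ac)).
  rewrite -(linear_sub _ _ (linear_iter n (Ul a))); apply: Nit => //; exact: (defect_in ds).
- move=> c b y cs; rewrite /tN; case: asboolP => [ca h n|ca h p].
    have [ab|ab] := pselect (a = b); first by rewrite -ab tU_self -PoszD h.
    by rewrite tU_other // h U0 scaler0.
  have {}cs : List.In c s by case: cs => // ac; case: ca.
  have [ab|ab] := pselect (a = b); first by rewrite -ab tU_self.
  by rewrite tU_other //; apply: (pd_spaceZ pd) => //; apply: (defectU ds).
- move=> c b y cs bs cb; rewrite /tN; case: asboolP => [ca h n|ca h p].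
    have ab : a <> b by rewrite -ca.
    have {}bs : List.In b s by case: bs.
    by rewrite tUi_other // h (_ : Ui b 0 = 0) ?scaler0 // -{1}(U0 b) (qsysK sys).
  have {}cs : List.In c s by case: cs => // ac; case: ca.
  have [ab|ab] := pselect (a = b); first by rewrite -ab tUi_self.
  have {}bs : List.In b s by case: bs.
  by rewrite tUi_other //; apply: (pd_spaceZ pd) => //; apply: (defectUi ds).
move=> c y x cs; have [n [yn _]] := valid_common y y.
rewrite (tformE yn (valid_le (leq0n n) (tJ_valid x))) /window => hN.
have B0 u : B 0 u = 0 by have := preipZ PB 0 0 u; rewrite scale0r mul0r.
have B0r u : B u 0 = 0 by rewrite (preipJ PB) B0 rmorph0.
move: hN; rewrite /tN; case: asboolP => [ca h|ca h].
  rewrite h B0 addr0 big1 // => i _; case: (i%:Z - n%:Z) => m; first by rewrite h U0 !B0 subrr.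
  by rewrite tJE U0 !B0r subrr.
have {}cs : List.In c s by case: cs => // ac; case: ca.
rewrite tJE_JT (defect_orth ds _ cs) // addr0 big1 // => i _; case: (i%:Z - n%:Z) => m; last first.
  by rewrite tJE U0 !B0r subrr.
rewrite tJE_JT -(pd_intertwine pd) // !(defect_orth ds _ cs) ?subrr //.
exact: (defectU ds).
Qed.

Lemma trace_partial_dilation : partial_dilation (a :: s) tform tU tUi tJ tN.
Proof.
split.
- exact: tform_preip.
- exact: trace_sys.
- by move=> b y z; exact: tform_iso.
- by move=> t nd ts y; exact: tform_defect_ge0.
- move=> c x y; apply: trace_ext => p; rewrite smod_valZDp !tJE (pd_linear pd).
  by case: p => n; rewrite ?scaler0 ?addr0 // (linear_iter n (Ul a)).
- move=> x y; rewrite (tformE (tJ_valid x) (tJ_valid y)) /window big_geq // add0r !tJE.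
  exact: (pd_isom pd).
- move=> b x bs; have ab : a <> b by move=> ab; apply: bs; left.
  have bs' : ~ List.In b s by move=> h; apply: bs; right.
  apply: trace_ext => p; rewrite tU_other // !tJE (pd_intertwine pd) //.
  case: p => n; last by rewrite U0 scaler0.
  by rewrite (qcomm_iterl n (Ul a) (qsys_comm sys ab)).
- exact: trace_defect_space.
move=> c k y cs; rewrite /tN; case: asboolP => [ca h n|ca h p].
  by rewrite smod_valZp h scaler0.
have {}cs : List.In c s by case: cs => // ac; case: ca.
by rewrite smod_valZp; apply: (pd_spaceZ pd).
Qed.

End Step.

Lemma partial_dilation_exists (s : seq L) : inner_product ipH ->
  (forall a, linear (T a)) -> q_commuting q T -> List.NoDup s ->
  (forall t, List.NoDup t -> forall x, 0 <= defect ipH T t x x) ->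
  exists (V : lmodType C) (B : V -> V -> C) U Ui J N, @partial_dilation s V B U Ui J N.
Proof.
move=> iH Tl Tq nd pos; elim: s nd => [_|a s IH /List.NoDup_cons_iff[as' nd]].
  (* No operator is unitary yet, so the conditions on the inverses and on the spaces [N] are
     vacuous; the second [T] and the constant predicate are placeholders. *)
  exists H, ipH, T, T, idfun, (fun _ _ => True); split => //.
  - exact: inner_preip.
  - by move=> t ndt _ x; exact: pos.
have [V [B [U [Ui [J [N pd]]]]]] := IH nd.
by do 6!eexists; exact: (trace_partial_dilation pd as').
Qed.
End PartialDilation.

(** * Sufficiency *)

Section Sufficiency.
Variables (R : realType) (L : Type) (q : L -> L -> R[i]).
Local Notation C := R[i].
Hypothesis qU : unimodular_q q.
Variables (H : lmodType C) (ipH : H -> H -> C) (T : L -> H -> H).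
Hypothesis iH : inner_product ipH.
Hypothesis Tl : forall a, linear (T a).
Hypothesis Tq : q_commuting q T.
Hypothesis pos : forall t, List.NoDup t -> forall x, 0 <= defect ipH T t x x.
Local Notation word := (seq (L * bool)).
Local Notation comb := (seq (C * (word * H))).

Lemma NoDup_cover (l : seq L) : exists2 s, List.NoDup s & forall b, List.In b l -> List.In b s.
Proof.
elim: l => [|a l [s nd ls]]; first by exists [::]; [constructor|].
have [as'|as'] := pselect (List.In a s); first by exists s => // b [<-|/ls].
exists (a :: s); first exact/List.NoDup_cons_iff.
by move=> b /= [->|/ls]; [left|right].
Qed.

Lemma local_dilation (l : seq L) : exists s (V : lmodType C) B U Ui J N,
  @partial_dilation _ _ q _ ipH T s V B U Ui J N /\ forall b, List.In b l -> List.In b s.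
Proof.
have [s nd ls] := NoDup_cover l; exists s.
by have [V [B [U [Ui [J [N pd]]]]]] := partial_dilation_exists qU iH Tl Tq nd pos; exists V, B, U, Ui, J, N.
Qed.

Lemma pd_regular s (V : lmodType C) B U Ui J N : @partial_dilation _ _ q _ ipH T s V B U Ui J N ->
  regular_form q ipH T B U Ui J (fun a => List.In a s).
Proof.
move=> pd; apply: regular_of_defect_space (pd_space pd) => //.
- exact: pd_preip pd.
- exact: pd_sys pd.
- exact: pd_iso pd.
- exact: pd_isom pd.
Qed.

Lemma word_form : exists Phi : word -> H -> H -> C,
  forall w s (V : lmodType C) B U Ui J N, @partial_dilation _ _ q _ ipH T s V B U Ui J N ->
  (forall b, List.In b [seq r.1 | r <- w] -> List.In b s) ->
  forall x x', B (act U Ui w (J x)) (J x') = Phi w x x'.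
Proof.
suff /choice[Phi hPhi] : forall w : word, exists F : H -> H -> C,
  forall s (V : lmodType C) B U Ui J N, @partial_dilation _ _ q _ ipH T s V B U Ui J N ->
  (forall b, List.In b [seq r.1 | r <- w] -> List.In b s) ->
  forall x x', B (act U Ui w (J x)) (J x') = F x x' by exists Phi.
move=> w; have [c [l [nd [lw h]]]] := word_normal qU w.
exists (fun x x' => c * (phase q l * ipH (pact T (posl l) x) (pact T (rev (negl l)) x'))).
move=> s V B U Ui J N pd ws x x'; rewrite (h _ _ _ _ (pd_sys pd) ws) (preipZ (pd_preip pd)).
by congr (_ * _); apply: (pd_regular pd) => // b /lw/ws.
Qed.

Definition word_adj (w : word) : word := rev [seq (p.1, ~~ p.2) | p <- w].
Definition comb_letters (v : comb) : seq L := flatten [seq [seq p.1 | p <- r.2.1] | r <- v].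
Definition comb_scale (c : C) (v : comb) : comb := [seq (c * r.1, r.2) | r <- v].
Definition comb_push (p : L * bool) (v : comb) : comb := [seq (r.1, (p :: r.2.1, r.2.2)) | r <- v].

Section Local.
Variables (s : seq L) (V : lmodType C) (B : V -> V -> C) (U Ui : L -> V -> V)
  (J : H -> V) (N : L -> V -> Prop).
Hypothesis pd : partial_dilation q ipH T s B U Ui J N.
Let sys := pd_sys pd.
Let PB := pd_preip pd.

Definition comb_eval (v : comb) : V := \sum_(r <- v) r.1 *: act U Ui r.2.1 (J r.2.2).

Lemma comb_eval_cat u v : comb_eval (u ++ v) = comb_eval u + comb_eval v.
Proof. by rewrite /comb_eval big_cat. Qed.
Lemma comb_eval_scale c v : comb_eval (comb_scale c v) = c *: comb_eval v.
Proof.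
rewrite /comb_eval big_map scaler_sumr; apply: eq_bigr => r _.
by rewrite scalerA.
Qed.
Lemma comb_eval_push p v : List.In p.1 s -> comb_eval (comb_push p v) = letter U Ui p (comb_eval v).
Proof.
move=> ps; have pl := letter_linear sys ps; rewrite /comb_eval big_map.
elim: v => [|r v IH]; first by rewrite !big_nil -{2}(scale0r (0 : V)) (linear_scale _ _ pl) scale0r.
by rewrite !big_cons IH pl.
Qed.

Lemma pd_adj a y z : List.In a s -> B (Ui a y) z = B y (U a z).
Proof. by move=> ai; rewrite -(pd_iso pd _ _ ai) (qsysVK sys). Qed.

Lemma act_adj w y z : (forall b, List.In b [seq r.1 | r <- w] -> List.In b s) ->
  B y (act U Ui w z) = B (act U Ui (word_adj w) y) z.
Proof.
elim: w y => [//|p w IH] y ws /=.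
have ps : List.In p.1 s by apply: ws; left.
rewrite /word_adj /= rev_cons -cats1 /act foldr_cat -/(act U Ui (word_adj w) _) -IH; last first.
  by move=> b bw; apply: ws; right.
rewrite /= /letter /=; case: p.2 => /=; last by rewrite -(pd_iso pd _ _ ps) (qsysVK sys).
by rewrite pd_adj.
Qed.
End Local.

Variable Phi : word -> H -> H -> C.
Hypothesis PhiP : forall w s (V : lmodType C) B U Ui J N,
  @partial_dilation _ _ q _ ipH T s V B U Ui J N ->
  (forall b, List.In b [seq r.1 | r <- w] -> List.In b s) ->
  forall x x', B (act U Ui w (J x)) (J x') = Phi w x x'.

(** The Gram form that any dilation must induce: the inner product of [U_w J x] with [U_w' J x'] is
    the value of the word [w'^* w] at [x] and [x']. *)
Definition comb_form (v u : comb) : C := \sum_(r <- v) \sum_(t <- u)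
  r.1 * t.1^* * Phi (word_adj t.2.1 ++ r.2.1) r.2.2 t.2.2.

Lemma comb_letters_in (v : comb) r b : List.In r v -> List.In b [seq p.1 | p <- r.2.1] ->
  List.In b (comb_letters v).
Proof.
elim: v => //= t v IH [->|rv] br; apply/List.in_app_iff; [by left|right; exact: IH].
Qed.

Lemma word_adj_letters w b : List.In b [seq p.1 | p <- word_adj w] -> List.In b [seq p.1 | p <- w].
Proof.
elim: w => //= p w IH; rewrite /word_adj /= rev_cons -cats1 map_cat.
by move=> /List.in_app_iff[/IH|[<-|//]]; [right|left].
Qed.

Lemma eq_big_In (A : Type) (F G : A -> C) (v : seq A) : (forall r, List.In r v -> F r = G r) ->
  \sum_(r <- v) F r = \sum_(r <- v) G r.
Proof.
elim: v => [|r v IH] h; first by rewrite !big_nil.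
by rewrite !big_cons h ?IH //; [move=> t tv; apply: h; right|left].
Qed.

(** The transfer principle of the construction: any identity or inequality for [comb_form] involves
    finitely many letters and can be verified in one partial dilation that covers them. *)
Lemma comb_formE s (V : lmodType C) B U Ui J N v u :
  @partial_dilation _ _ q _ ipH T s V B U Ui J N ->
  (forall b, List.In b (comb_letters v) -> List.In b s) ->
  (forall b, List.In b (comb_letters u) -> List.In b s) ->
  comb_form v u = B (comb_eval U Ui J v) (comb_eval U Ui J u).
Proof.
move=> pd vs us; have PB := pd_preip pd.
have Bs0 z : B 0 z = 0 by have := preipZ PB 0 0 z; rewrite scale0r mul0r.
have Bsum w z : B (comb_eval U Ui J w) z = \sum_(r <- w) r.1 * B (act U Ui r.2.1 (J r.2.2)) z.
  rewrite /comb_eval; elim: w => [|r w IH]; first by rewrite !big_nil.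
  by rewrite !big_cons (preipD PB) (preipZ PB) IH.
rewrite Bsum; apply: eq_big_In => r rv.
rewrite (preipJ PB) Bsum rmorph_sum mulr_sumr; apply: eq_big_In => t tu.
rewrite rmorphM /= -(preipJ PB) mulrA; congr (_ * _).
rewrite (act_adj pd); last by move=> b bt; apply: us; exact: comb_letters_in tu bt.
rewrite /act -foldr_cat -(PhiP pd) // => b; rewrite map_cat => /List.in_app_iff[/word_adj_letters bt|br].
  by apply: us; exact: comb_letters_in tu bt.
by apply: vs; exact: comb_letters_in rv br.
Qed.

Lemma comb_letters_cat u v b : List.In b (comb_letters (u ++ v)) <->
  List.In b (comb_letters u) \/ List.In b (comb_letters v).
Proof. by rewrite /comb_letters map_cat flatten_cat List.in_app_iff. Qed.
Lemma comb_letters_scale c u : comb_letters (comb_scale c u) = comb_letters u.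
Proof. by rewrite /comb_letters -map_comp. Qed.
Lemma comb_letters_push p u b : List.In b (comb_letters (comb_push p u)) ->
  b = p.1 \/ List.In b (comb_letters u).
Proof.
elim: u => //= r u IH [<-|/List.in_app_iff[h|/IH[->|h]]]; [by left| | by left|].
  by right; apply/List.in_app_iff; left.
by right; apply/List.in_app_iff; right.
Qed.

Lemma comb_form_preip : preip cat comb_scale comb_form.
Proof.
split.
- move=> u v w.
  have [s [V [B [U [Ui [J [N [pd hs]]]]]]]] := local_dilation (comb_letters (u ++ v) ++ comb_letters w).
  have hw b : List.In b (comb_letters w) -> List.In b s by move=> h; apply: hs; apply/List.in_app_iff; right.
  have hc b : List.In b (comb_letters (u ++ v)) -> List.In b s by move=> h; apply: hs; apply/List.in_app_iff; left.
  rewrite !(comb_formE pd) ?comb_eval_cat ?(preipD (pd_preip pd)) // => b h; apply: hc; apply/comb_letters_cat.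
    by right.
  by left.
- move=> c u w.
  have [s [V [B [U [Ui [J [N [pd hs]]]]]]]] := local_dilation (comb_letters u ++ comb_letters w).
  have hw b : List.In b (comb_letters w) -> List.In b s by move=> h; apply: hs; apply/List.in_app_iff; right.
  have hu b : List.In b (comb_letters u) -> List.In b s by move=> h; apply: hs; apply/List.in_app_iff; left.
  by rewrite !(comb_formE pd) ?comb_letters_scale ?comb_eval_scale ?(preipZ (pd_preip pd)).
- move=> u w.
  have [s [V [B [U [Ui [J [N [pd hs]]]]]]]] := local_dilation (comb_letters u ++ comb_letters w).
  have hw b : List.In b (comb_letters w) -> List.In b s by move=> h; apply: hs; apply/List.in_app_iff; right.
  have hu b : List.In b (comb_letters u) -> List.In b s by move=> h; apply: hs; apply/List.in_app_iff; left.
  by rewrite !(comb_formE pd) // (preipJ (pd_preip pd)).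
move=> u; have [s [V [B [U [Ui [J [N [pd hs]]]]]]]] := local_dilation (comb_letters u).
by rewrite (comb_formE pd hs hs); exact: (preip_ge0 (pd_preip pd)).
Qed.

Lemma comb_local (a : seq L) (u v : comb) : exists s (V : lmodType C) B U Ui J N,
  @partial_dilation _ _ q _ ipH T s V B U Ui J N /\
  [/\ forall b, List.In b a -> List.In b s,
      forall b, List.In b (comb_letters u) -> List.In b s &
      forall b, List.In b (comb_letters v) -> List.In b s].
Proof.
have [s [V [B [U [Ui [J [N [pd hs]]]]]]]] := local_dilation (a ++ comb_letters u ++ comb_letters v).
exists s, V, B, U, Ui, J, N; split => //; split=> b h; apply: hs; apply/List.in_app_iff; first by left.
  by right; apply/List.in_app_iff; left.
by right; apply/List.in_app_iff; right.
Qed.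

Lemma push_sub s p (u : comb) : (forall b, List.In b (comb_letters u) -> List.In b s) -> List.In p.1 s ->
  forall b, List.In b (comb_letters (comb_push p u)) -> List.In b s.
Proof. by move=> us ps b /comb_letters_push[->|/us]. Qed.

Lemma comb_push_adj a e u v : comb_form (comb_push (a, e) u) v = comb_form u (comb_push (a, ~~ e) v).
Proof.
have [s [V [B [U [Ui [J [N [pd [ha hu hv]]]]]]]]] := comb_local [:: a] u v.
have as' : List.In a s by apply: ha; left.
have pu := push_sub (p := (a, e)) hu as'; have pv := push_sub (p := (a, ~~ e)) hv as'.
rewrite !(comb_formE pd) // !(comb_eval_push pd) // /letter /=.
case: e {pu pv} => /=; last exact: (pd_adj pd).
by rewrite (preipJ (pd_preip pd)) -(pd_adj pd) // -(preipJ (pd_preip pd)).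
Qed.

Lemma comb_pushK a e u v : comb_form u (comb_push (a, e) (comb_push (a, ~~ e) v)) = comb_form u v.
Proof.
have [s [V [B [U [Ui [J [N [pd [ha hu hv]]]]]]]]] := comb_local [:: a] u v.
have as' : List.In a s by apply: ha; left.
have pv := push_sub (p := (a, ~~ e)) hv as'; have pv' := push_sub (p := (a, e)) pv as'.
rewrite !(comb_formE pd) // !(comb_eval_push pd) // /letter /=.
by case: e {pv pv'} => /=; rewrite ?(qsysK (pd_sys pd)) ?(qsysVK (pd_sys pd)).
Qed.

Lemma comb_push_iso a e u v : comb_form (comb_push (a, e) u) (comb_push (a, e) v) = comb_form u v.
Proof. by rewrite comb_push_adj -{2}[e]negbK comb_pushK. Qed.

(** Inverse letters are used because the operators of the completion will be moved as adjoints onto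
    a vector [i u], where they become pushes of inverse letters. *)
Lemma comb_push_comm a b u v : a <> b ->
  comb_form u (comb_push (b, false) (comb_push (a, false) v)) =
  q a b * comb_form u (comb_push (a, false) (comb_push (b, false) v)).
Proof.
move=> ab; have [s [V [B [U [Ui [J [N [pd [ha hu hv]]]]]]]]] := comb_local [:: a; b] u v.
have as' : List.In a s by apply: ha; left.
have bs' : List.In b s by apply: ha; right; left.
have ba : b <> a by move=> ba; apply: ab.
have pa := push_sub (p := (a, false)) hv as'; have pb := push_sub (p := (b, false)) hv bs'.
have pba := push_sub (p := (b, false)) pa bs'; have pab := push_sub (p := (a, false)) pb as'.
rewrite !(comb_formE pd) // !(comb_eval_push pd) // /letter /=.
rewrite (qsys_UiUi qU (pd_sys pd) ba bs' as') (preipZr (pd_preip pd)); congr (_ * _).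
have [_ ->] := qU ab; apply: (mulfI (q_neq0 qU ba)); rewrite q_conj // mulfV //.
exact: q_neq0.
Qed.

Definition zword (l : seq (L * int)) : word :=
  flatten [seq match r.2 with Posz n => nseq n (r.1, true) | Negz n => nseq n.+1 (r.1, false) end | r <- l].

Lemma zwordE (V : lmodType C) (U Ui : L -> V -> V) l x : act U Ui (zword l) x = oact U Ui l x.
Proof.
elim: l => //= -[a m] l IH; rewrite /zword /= /act foldr_cat -/(zword l) -/(act U Ui (zword l) x) IH.
by case: m => n /=; [|congr (Ui a _)]; elim: n => //= n ->.
Qed.

Definition comb1 (w : word) (x : H) : comb := [:: (1, (w, x))].

Lemma sufficiency : exists (K : lmodType C) (ip : K -> K -> C) (J : H -> K) (U U' : L -> K -> K),
  hilbert ip /\ isometric_embedding ipH ip J /\ (forall a, linear (U a)) /\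
  (forall a f g, ip (U a f) g = ip f (U' a g)) /\
  (forall a, cancel (U a) (U' a)) /\ (forall a, cancel (U' a) (U a)) /\
  q_commuting q U /\ regular_form q ipH T ip U U' J (fun=> True).
Proof.
have [K [ip [i [U [U' [hK [iiso [itot [Ul [Uadj [UK [U'K Ui]]]]]]]]]]]] :=
  completion (S := fun a => comb_push (a, true)) (S' := fun a => comb_push (a, false))
    comb_form_preip (inhabits [::]) (fun a => @comb_push_adj a true)
    (fun a => @comb_push_iso a true) (fun a => @comb_push_iso a false).
have pK := inner_preip hK.1.
have itot_eq f g : (forall u, ip (i u) f = ip (i u) g) -> f = g.
  move=> h; apply/eqP; rewrite -subr_eq0; apply/eqP/itot => u.
  by have := preipBr pK f g (i u); rewrite /psub scaleN1r h subrr.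
have U'i a u : U' a (i u) = i (comb_push (a, false) u).
  rewrite -[RHS](UK a) Ui; congr (U' a _); apply: itot_eq => v.
  by rewrite !iiso (comb_pushK a true).
have Ji w x : act U U' w (i (comb1 [::] x)) = i (comb1 w x).
  elim: w => [//|[a e] w IH] /=; rewrite IH /letter /=.
  by case: e; rewrite ?Ui ?U'i.
have ev1 (V : lmodType C) (F F' : L -> V -> V) J w x : comb_eval F F' J (comb1 w x) = act F F' w (J x).
  by rewrite /comb_eval big_seq1 scale1r.
exists K, ip, (fun x => i (comb1 [::] x)), U, U'.
split=> //; split; [split|split=> //; split=> //; split=> //; split=> //; split].
(* [i] is not known to be linear; linearity of [J] is tested against the total family [i u] and
   computed in a partial dilation. *)
- move=> c x y; apply: itot_eq => u.
  rewrite (preipDr pK) (preipZr pK) !iiso.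
  have [s [V [B [F [F' [J [N [pd [ha hu hv]]]]]]]]] := comb_local [::] u [::].
  rewrite !(comb_formE pd) // !ev1 /= (pd_linear pd).
  by rewrite (preipDr (pd_preip pd)) (preipZr (pd_preip pd)).
- move=> x y; rewrite iiso; have [s [V [B [F [F' [J [N [pd _]]]]]]]] := comb_local [::] [::] [::].
  by rewrite (comb_formE pd) // !ev1 /= (pd_isom pd).
- move=> a b ab f; apply: (itot_eq _ _) => u.
  (* The vector [f] is an arbitrary element of the completion, so commutation is first established
     on the vectors [i u] for the adjoints and then carried to [f] by duality. *)
  have ic : i (comb_push (b, false) (comb_push (a, false) u)) =
      (q a b)^* *: i (comb_push (a, false) (comb_push (b, false) u)).
    by apply: itot_eq => v; rewrite (preipZr pK) conjCK !iiso comb_push_comm.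
  rewrite (preipZr pK) !(preipJ pK _ (i u)) !Uadj !U'i ic (preipZr pK) rmorphM /=.
  by rewrite conjCK.
move=> l nd _ x x'; rewrite -zwordE Ji iiso.
have [s [V [B [F [F' [J [N [pd [hl hu hv]]]]]]]]] :=
  comb_local [seq r.1 | r <- l] (comb1 (zword l) x) (comb1 [::] x').
by rewrite (comb_formE pd) // !ev1 zwordE; apply: (pd_regular pd).
Qed.
End Sufficiency.

Theorem theorem1p12 (R : realType) (H : lmodType R[i]) (ipH : H -> H -> R[i])
  (L : Type) (q : L -> L -> R[i]) (T : L -> H -> H) :
  hilbert ipH ->
  unimodular_q q ->
  (forall a : L, contraction ipH (T a)) ->
  q_commuting q T ->
  (admits_regular_q_unitary_dilation ipH q T <->
   forall u : seq L, List.NoDup u -> positive_op ipH (S_op ipH T u)).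
Proof.
move=> hH qU Tc Tq; have iH := hH.1; have Tl a := contraction_linear Tc a.
split=> [[K [ip [J [U [hK [Jis Uun Uq cl]]]]]] s nd x|pos].
  have iK := hK.1; have pK := inner_preip iK.
  have adj a : exists2 S, (forall x y, ip (U a x) y = ip x (S y)) & cancel (U a) S /\ cancel S (U a).
    by have [_ [S [h1 h2]]] := Uun a; exists S.
  have sys : qsys q (fun=> True) U (fun a => hadj ip ip (U a)).
    split=> // [a|a _|a _]; first exact: (Uun a).1.
      by have [S h1 [h2 h3]] := adj a; rewrite (hadj_unique iK h1).
    by have [S h1 [h2 h3]] := adj a; rewrite (hadj_unique iK h1).
  rewrite (S_op_defect qU hH Tc Tq _ nd).
  rewrite -(@defect_vec_norm _ _ _ qU _ ipH T Tq K ip J U (fun a => hadj ip ip (U a)) pK _ _ sys) //.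
  - exact: (preip_ge0 pK).
  - exact: Jis.1.
  - exact: Jis.2.
  - by move=> a y z; have [S h1 _] := adj a; rewrite (hadj_unique iK h1).
  - exact/(regular_clause q hH Tc U iK Jis).
have pos' t : List.NoDup t -> forall x, 0 <= defect ipH T t x x.
  by move=> nd x; rewrite -(S_op_defect qU hH Tc Tq _ nd); exact: pos.
have [Phi PhiP] := word_form qU ipH T.
have [K [ip [J [U [U' [hK [Jis [Ul [Uadj [UK [U'K [Uq reg]]]]]]]]]]]] := sufficiency qU iH Tl Tq pos' PhiP.
exists K, ip, J, U; split=> //; split=> //.
  by move=> a; split=> //; exists (U' a).
apply/(regular_clause q hH Tc U hK.1 Jis).
(* The clause is phrased with the adjoint selected by [hadj]; uniqueness of adjoints identifies it
   with the inverse [U']. *)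
rewrite (_ : (fun a => hadj ip ip (U a)) = U') //.
by apply/funext => a; apply: (hadj_unique hK.1).
Qed.
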